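(* Let $(R,\mathfrak m)$ be a commutative Noetherian local ring, let $\mathfrak a\subseteq\mathfrak m$ be an ideal of $R$, and let $M$ be a finitely generated $R$-module. Suppose that $\varprojlim_n H^i_{\mathfrak m}(M/\mathfrak a^nM)=0$ for $i\le 1$. Then $V(\mathfrak a\hat R,\mathfrak p)\setminus V(\hat{\mathfrak m})$ is connected for all $\mathfrak p\in\operatorname{Ass}_{\hat R}\hat M$.
   Context: $(\hat R,\hat{\mathfrak m})$ is the $\mathfrak m$-adic completion of $(R,\mathfrak m)$ and $\hat M$ that of $M$. $H^i_{\mathfrak m}$ denotes local cohomology; the inverse limit is along the maps induced by $M/\mathfrak a^{n+1}M\to M/\mathfrak a^nM$. $V(\mathfrak a\hat R,\mathfrak p)\subseteq\operatorname{Spec}\hat R$ is the closed set defined by the ideal $\mathfrak a\hat R+\mathfrak p$, with the Zariski topology. *)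

(* Defs.v *)
From HB Require Import structures.
From mathcomp Require Import all_boot all_order all_algebra.
From mathcomp Require Import generic_quotient ring_quotient.
From mathcomp Require Import boolp classical_sets functions topology.

Set Implicit Arguments.
Unset Strict Implicit.
Unset Printing Implicit Defensive.

Import GRing.Theory.
Local Open Scope classical_set_scope.
Local Open Scope ring_scope.
Local Open Scope quotient_scope.

(* Rings are of type comPzRingType, i.e. 1 = 0 is allowed, so that the
   quotient R / I is a ring for every ideal I, in particular for I = m^0. *)

Record submodule (R : comPzRingType) (V : lmodType R) := Submodule {
  submod_set :> V -> Prop;
  submod0 : submod_set 0;
  submodD : forall x y, submod_set x -> submod_set y -> submod_set (x + y);
  submodZ : forall r x, submod_set x -> submod_set (r *: x) }.

Notation ideal A := (submodule A^o).

Section Submodules.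
Variables (R : comPzRingType) (V : lmodType R).
Implicit Types (S T : submodule V).

Lemma submodN S x : S x -> S (- x).
Proof. by move=> Sx; rewrite -scaleN1r; exact: submodZ. Qed.

Lemma submodB S x y : S x -> S y -> S (x - y).
Proof. by move=> Sx Sy; apply: submodD => //; exact: submodN. Qed.

Definition full_submodule : submodule V :=
  @Submodule R V setT I (fun _ _ _ _ => I) (fun _ _ _ => I).

Program Definition zero_submodule : submodule V := @Submodule R V [set 0] _ _ _.
Next Obligation. by []. Qed.
Next Obligation. by move=> x y -> ->; rewrite addr0. Qed.
Next Obligation. by move=> r x ->; rewrite scaler0. Qed.

Program Definition span (G : set V) : submodule V :=
  @Submodule R V [set x | forall S, G `<=` S -> S x] _ _ _.
Next Obligation. by move=> G S _; exact: submod0. Qed.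
Next Obligation.
by move=> G x y Hx Hy S GS; apply: submodD; [exact: Hx|exact: Hy].
Qed.
Next Obligation. by move=> G r x Hx S GS; apply: submodZ; exact: Hx. Qed.

Definition submodule_sum S T : submodule V := span (S `|` T).

Definition finitely_generated S := exists s : seq V, span [set` s] = S :> set V.

Definition ideal_smul (I : ideal R) S : submodule V :=
  span [set v | exists r x, [/\ I r, S x & v = r *: x]].

End Submodules.

Arguments full_submodule {R} V.
Arguments zero_submodule {R} V.

Section Ideals.
Variable A : comPzRingType.
Implicit Types I J m : ideal A.

Definition ideal_pow I n : ideal A := iter n (ideal_smul I) (full_submodule A^o).

Definition noetherian := forall I, finitely_generated I.

Definition maximal_ideal m :=
  ~ m 1 /\ forall I, m `<=` I -> ~ I 1 -> I = m :> set A.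

Definition local_ring m :=
  maximal_ideal m /\ forall I, maximal_ideal I -> I = m :> set A.

Lemma ideal_powS I n : ideal_pow I n.+1 `<=` ideal_pow I n.
Proof. by move=> x; apply => _ [r [y [_ Iy ->]]]; exact: submodZ. Qed.

Lemma ideal_pow_le I n k : (n <= k)%N -> ideal_pow I k `<=` ideal_pow I n.
Proof.
move=> /subnK <-; elim: (k - n)%N => // d IHd x /ideal_powS.
exact: IHd.
Qed.

End Ideals.
Arguments noetherian : clear implicits.

Record Spec (A : comPzRingType) := PrimeIdeal {
  prime_ideal :> ideal A;
  prime_proper : ~ prime_ideal 1;
  prime_mul : forall x y : A, prime_ideal (x * y) -> prime_ideal x \/ prime_ideal y }.

HB.instance Definition _ (A : comPzRingType) := gen_eqMixin (Spec A).
HB.instance Definition _ (A : comPzRingType) := gen_choiceMixin (Spec A).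

Section Zariski.
Variable A : comPzRingType.
Implicit Types I J : ideal A.

Definition Vspec I : set (Spec A) := [set q : Spec A | I `<=` q].

Definition zariski_open : set_system (Spec A) :=
  [set U | exists I, U = ~` Vspec I].

Let openT : zariski_open setT.
Proof.
exists (full_submodule A^o); apply/esym/seteqP; split=> // q _ /(_ 1 I).
exact: prime_proper.
Qed.

Let openI : setI_closed zariski_open.
Proof.
move=> _ _ [I ->] [J ->]; exists (ideal_smul I J).
rewrite -setCU; congr (~` _); apply/seteqP; split=> q /=.
- move=> [Iq|Jq] x; apply=> _ [r [y [Ir Jy ->]]].
    by rewrite /GRing.scale/= mulrC; apply: (@submodZ _ A^o); exact: Iq.
  by apply: submodZ; exact: Jq.
- move=> IJq; apply: contrapT => /not_orP[nI nJ].
  have [x [Ix nx]] : exists x, I x /\ ~ q x.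
    by apply: contrapT => /forallNP H; apply: nI => x Ix;
      apply: contrapT => nx; exact: (H x).
  have [y [Jy ny]] : exists y, J y /\ ~ q y.
    by apply: contrapT => /forallNP H; apply: nJ => y Jy;
      apply: contrapT => ny; exact: (H y).
  have : q (x * y) by apply: IJq => S; apply; exists x, y.
  by case/prime_mul.
Qed.

Let open_bigU (I : Type) (f : I -> set (Spec A)) :
  (forall i, zariski_open (f i)) -> zariski_open (\bigcup_i f i).
Proof.
move=> /choice[J fJ]; exists (span (\bigcup_i (J i : set A^o))).
apply: setC_inj; rewrite setCK setC_bigcup; apply/seteqP; split=> q /=.
- move=> H x; apply=> y [i _ Jy]; have := H i Logic.I; rewrite fJ setCK.
  exact.
- move=> H i _; rewrite fJ setCK => x Jx; apply: H => S; apply.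
  by exists i.
Qed.

HB.instance Definition _ :=
  isOpenTopological.Build (Spec A) openT openI open_bigU.

End Zariski.

Section SubQuotient.
Variables (R : comPzRingType) (N : lmodType R) (S : submodule N).

Definition submod_pred : {pred N} := fun x => `[< S x >].

Lemma submod_predP x : reflect (S x) (x \in submod_pred).
Proof. exact: asboolP. Qed.

Let submod_pred_closed : subsemimod_closed submod_pred.
Proof.
split; first split.
- by apply/submod_predP; exact: submod0.
- by move=> x y /submod_predP Sx /submod_predP Sy; apply/submod_predP; exact: submodD.
- by move=> r x /submod_predP Sx; apply/submod_predP; exact: submodZ.
Qed.

HB.instance Definition _ := GRing.isSubmodClosed.Build R N submod_pred submod_pred_closed.

Definition submod_type : Type := {x : N | submod_pred x}.

HB.instance Definition _ := SubChoice.on submod_type.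
HB.instance Definition _ :=
  [SubChoice_isSubLmodule of submod_type by <:].

Definition quotmod : Type := Quotient.quot submod_pred.

HB.instance Definition _ := Choice.on quotmod.
HB.instance Definition _ := EqQuotient.on quotmod.
HB.instance Definition _ := GRing.Zmodule.on quotmod.

Lemma quotmodP (x y : N) : S (x - y) <-> \pi_quotmod x = \pi_quotmod y.
Proof.
split=> [Sxy|/eqP]; first by apply/eqP; rewrite -Quotient.idealrBE; apply/submod_predP.
by rewrite -Quotient.idealrBE => /submod_predP.
Qed.

Lemma quotmod_repr (x : N) : S (repr (\pi_quotmod x) - x).
Proof. by apply/quotmodP; rewrite reprK. Qed.

Lemma quotmod_piB (x y : N) : \pi_quotmod (x - y) = \pi_quotmod x - \pi_quotmod y.
Proof. exact: (raddfB (\pi_(Quotient.quot submod_pred))). Qed.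

Lemma quotmod_piD (x y : N) : \pi_quotmod (x + y) = \pi_quotmod x + \pi_quotmod y.
Proof. exact: (raddfD (\pi_(Quotient.quot submod_pred))). Qed.

Definition quotmod_scale (r : R) (x : quotmod) : quotmod := \pi_quotmod (r *: repr x).

Lemma quotmod_scaleE r (x : N) : quotmod_scale r (\pi_quotmod x) = \pi_quotmod (r *: x).
Proof. by apply/quotmodP; rewrite -scalerBr; apply: submodZ; exact: quotmod_repr. Qed.

Let scaleA a b x : quotmod_scale a (quotmod_scale b x) = quotmod_scale (a * b) x.
Proof. by rewrite -[x]reprK (quotmod_scaleE b) !quotmod_scaleE scalerA. Qed.
Let scale1 : left_id 1 quotmod_scale.
Proof. by move=> x; rewrite -[x]reprK quotmod_scaleE scale1r. Qed.
Let scaleDr : right_distributive quotmod_scale +%R.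
Proof.
move=> a x y; rewrite -[x]reprK -[y]reprK -quotmod_piD !quotmod_scaleE.
by rewrite scalerDr quotmod_piD.
Qed.
Let scaleDl x : {morph quotmod_scale^~ x : a b / a + b}.
Proof.
by move=> a b; rewrite -[x]reprK !quotmod_scaleE scalerDl quotmod_piD.
Qed.

HB.instance Definition _ :=
  GRing.Zmodule_isLmodule.Build R quotmod scaleA scale1 scaleDr scaleDl.

Lemma quotmod_piZ r (x : N) : \pi_quotmod (r *: x) = r *: \pi_quotmod x.
Proof. exact: esym (quotmod_scaleE r x). Qed.

End SubQuotient.

Section InducedMaps.
Variables (R : comPzRingType) (N N' : lmodType R).
Variables (S : submodule N) (S' : submodule N') (g : {linear N -> N'}).
Hypothesis gS : forall x, S x -> S' (g x).

Let sub_subproof (x : submod_type S) : submod_pred S' (g (val x)).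
Proof. by apply/submod_predP/gS/submod_predP/(valP x). Qed.

Definition submod_map (x : submod_type S) : submod_type S' :=
  Sub (g (val x)) (sub_subproof x).

Let submod_map_linear : linear submod_map.
Proof. by move=> r x y; apply: val_inj; rewrite !linearP /= linearP. Qed.
HB.instance Definition _ :=
  GRing.isLinear.Build R (submod_type S) (submod_type S') *:%R submod_map submod_map_linear.

Definition quotmod_map & (forall x, S x -> S' (g x)) :=
  fun x : quotmod S => \pi_(quotmod S') (g (repr x)).

Lemma quotmod_mapE x : quotmod_map gS (\pi_(quotmod S) x) = \pi_(quotmod S') (g x).
Proof. by apply/quotmodP; rewrite -linearB; apply: gS; exact: quotmod_repr. Qed.

Let quotmod_map_linear : linear (quotmod_map gS).
Proof.
move=> r x y; rewrite -[x]reprK -[y]reprK -quotmod_piZ -quotmod_piD.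
by rewrite !quotmod_mapE linearP quotmod_piD quotmod_piZ.
Qed.
HB.instance Definition _ :=
  GRing.isLinear.Build R (quotmod S) (quotmod S') *:%R (quotmod_map gS) quotmod_map_linear.

End InducedMaps.

Section QuotientRing.
Variables (A : comPzRingType) (I : ideal A).

Definition quotring : Type := quotmod I.
HB.instance Definition _ := GRing.Zmodule.on quotring.

Definition quotring_pi (r : A) : quotring := \pi_(quotmod I) (r : A^o).

Lemma quotring_repr (x : quotring) : exists r, x = quotring_pi r.
Proof. by exists (repr (x : quotmod I)); rewrite /quotring_pi reprK. Qed.

Definition quot_act (N : lmodType A) (r : quotring)
    (x : quotmod (ideal_smul I (full_submodule N))) :=
  \pi_(quotmod (ideal_smul I (full_submodule N)))
    ((repr (r : quotmod I) : A) *: repr x).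

Lemma quot_actE (N : lmodType A) (r : A) (x : N) :
  quot_act (quotring_pi r) (\pi_(quotmod _) x) = \pi_(quotmod _) (r *: x).
Proof.
apply/quotmodP; set r' := repr _; set x' := repr _.
have -> : r' *: x' - r *: x = (r' - r) *: x' + r *: (x' - x).
  by rewrite scalerBl scalerBr addrA subrK.
apply: submodD.
  by move=> S; apply; exists (r' - r), x'; split=> //; exact: quotmod_repr.
by apply: submodZ; exact: quotmod_repr.
Qed.

Definition quotring_mul (x y : quotring) : quotring :=
  quotring_pi ((repr (x : quotmod I) : A) * repr (y : quotmod I)).

Lemma quotring_mulE r s :
  quotring_mul (quotring_pi r) (quotring_pi s) = quotring_pi (r * s).
Proof.
apply/quotmodP; set r' := repr _; set s' := repr _.
have -> : r' * s' - r * s = s' *: (r' - r : A^o) + r *: (s' - s : A^o).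
  rewrite /GRing.scale/= mulrBr mulrBr (mulrC s' r') (mulrC s' r).
  by rewrite addrA subrK.
by apply: submodD; apply: submodZ; exact: quotmod_repr.
Qed.

Lemma quotring_piD r s : quotring_pi (r + s) = quotring_pi r + quotring_pi s.
Proof. exact: quotmod_piD. Qed.

Let mulA : associative quotring_mul.
Proof.
move=> x y z; have [[[r ->] [s ->]] [t ->]] :=
  (quotring_repr x, quotring_repr y, quotring_repr z).
by rewrite !(quotring_mulE s, quotring_mulE r, quotring_mulE) mulrA.
Qed.
Let mulC : commutative quotring_mul.
Proof.
move=> x y; have [[r ->] [s ->]] := (quotring_repr x, quotring_repr y).
by rewrite !quotring_mulE mulrC.
Qed.
Let mul1 : left_id (quotring_pi 1) quotring_mul.
Proof.
by move=> x; have [r ->] := quotring_repr x; rewrite quotring_mulE mul1r.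
Qed.
Let mulDl : left_distributive quotring_mul +%R.
Proof.
move=> x y z; have [[[r ->] [s ->]] [t ->]] :=
  (quotring_repr x, quotring_repr y, quotring_repr z).
by rewrite -quotring_piD !quotring_mulE mulrDl quotring_piD.
Qed.

HB.instance Definition _ :=
  GRing.Zmodule_isComPzRing.Build quotring mulA mulC mul1 mulDl.

Lemma quotring_piM r s : quotring_pi (r * s) = quotring_pi r * quotring_pi s.
Proof. by rewrite -quotring_mulE. Qed.

Section QuotientAction.
Variable N : lmodType A.
Implicit Types (r s : quotring) (x y : quotmod (ideal_smul I (full_submodule N))).

Let quotmod_repr_pi x : exists u, x = \pi_(quotmod _) u.
Proof. by exists (repr x); rewrite reprK. Qed.

Lemma quot_actA r s x : quot_act r (quot_act s x) = quot_act (r * s) x.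
Proof.
have [[[a ->] [b ->]] [u ->]] :=
  (quotring_repr r, quotring_repr s, quotmod_repr_pi x).
by rewrite -quotring_piM (quot_actE b) !quot_actE scalerA.
Qed.
Lemma quot_act1 x : quot_act 1 x = x.
Proof. by have [u ->] := quotmod_repr_pi x; rewrite quot_actE scale1r. Qed.
Lemma quot_actDr r x y : quot_act r (x + y) = quot_act r x + quot_act r y.
Proof.
have [[[a ->] [u ->]] [v ->]] :=
  (quotring_repr r, quotmod_repr_pi x, quotmod_repr_pi y).
by rewrite -quotmod_piD !quot_actE scalerDr quotmod_piD.
Qed.
Lemma quot_actDl x r s : quot_act (r + s) x = quot_act r x + quot_act s x.
Proof.
have [[[a ->] [b ->]] [u ->]] :=
  (quotring_repr r, quotring_repr s, quotmod_repr_pi x).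
by rewrite -quotring_piD !quot_actE scalerDl quotmod_piD.
Qed.
End QuotientAction.

End QuotientRing.

Section InverseLimit.
Variables (R : comPzRingType) (N : nat -> lmodType R).
Variable f : forall n, {linear N n.+1 -> N n}.

Record invlim := InvLim {
  invlim_fun :> forall n, N n;
  invlimP : forall n, f n (invlim_fun n.+1) = invlim_fun n }.

HB.instance Definition _ := gen_eqMixin invlim.
HB.instance Definition _ := gen_choiceMixin invlim.

Lemma invlim_ext (x y : invlim) : (forall n, x n = y n) -> x = y.
Proof.
case: x y => [x Px] [y Py] /= xy.
have {}xy : x = y by apply: functional_extensionality_dep.
by case: _ / xy Py => Py; congr InvLim; exact: Prop_irrelevance.
Qed.

Program Definition invlim0 := @InvLim (fun=> 0) _.
Next Obligation. by move=> n; rewrite linear0. Qed.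
Program Definition invlimN (x : invlim) := @InvLim (fun n => - x n) _.
Next Obligation. by move=> x n; rewrite linearN invlimP. Qed.
Program Definition invlimD (x y : invlim) := @InvLim (fun n => x n + y n) _.
Next Obligation. by move=> x y n; rewrite linearD !invlimP. Qed.
Program Definition invlimZ r (x : invlim) := @InvLim (fun n => r *: x n) _.
Next Obligation. by move=> r x n; rewrite linearZ /= invlimP. Qed.

Let addA : associative invlimD.
Proof. by move=> x y z; apply: invlim_ext => n; exact: addrA. Qed.
Let addC : commutative invlimD.
Proof. by move=> x y; apply: invlim_ext => n; exact: addrC. Qed.
Let add0 : left_id invlim0 invlimD.
Proof. by move=> x; apply: invlim_ext => n; exact: add0r. Qed.
Let addN : left_inverse invlim0 invlimN invlimD.
Proof. by move=> x; apply: invlim_ext => n; exact: addNr. Qed.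
HB.instance Definition _ := GRing.isZmodule.Build invlim addA addC add0 addN.

Let scaleA a b x : invlimZ a (invlimZ b x) = invlimZ (a * b) x.
Proof. by apply: invlim_ext => n; exact: scalerA. Qed.
Let scale1 : left_id 1 invlimZ.
Proof. by move=> x; apply: invlim_ext => n; exact: scale1r. Qed.
Let scaleDr : right_distributive invlimZ +%R.
Proof. by move=> a x y; apply: invlim_ext => n; exact: scalerDr. Qed.
Let scaleDl x : {morph invlimZ^~ x : a b / a + b}.
Proof. by move=> a b; apply: invlim_ext => n; exact: scalerDl. Qed.
HB.instance Definition _ :=
  GRing.Zmodule_isLmodule.Build R invlim scaleA scale1 scaleDr scaleDl.

End InverseLimit.

Section AdicQuotient.
Variables (R : comPzRingType) (I : ideal R).

Definition ring_quotient n : lmodType R := quotmod (ideal_pow I n).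

Definition ring_proj n : {linear ring_quotient n.+1 -> ring_quotient n} :=
  quotmod_map (g := idfun : {linear R^o -> R^o}) (@ideal_powS R I n).

Definition adic_quotient (N : lmodType R) n : lmodType R :=
  quotmod (ideal_smul (ideal_pow I n) (full_submodule N)).

Lemma ideal_smul_powS (N : lmodType R) n (x : N) :
  ideal_smul (ideal_pow I n.+1) (full_submodule N) x ->
  ideal_smul (ideal_pow I n) (full_submodule N) (idfun x).
Proof.
move=> Hx S GS; apply: (Hx S) => _ [r [y [Ir _ ->]]]; apply: GS.
by exists r, y; split=> //; exact: ideal_powS.
Qed.

Definition adic_proj (N : lmodType R) n :
    {linear adic_quotient N n.+1 -> adic_quotient N n} :=
  quotmod_map (g := idfun : {linear N -> N}) (@ideal_smul_powS N n).

End AdicQuotient.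

Section CompletionRing.
Variables (R : comPzRingType) (I : ideal R).

Definition completion_ring : Type := invlim (@ring_proj R I).
HB.instance Definition _ := GRing.Zmodule.on completion_ring.

Definition completion_coord (x : completion_ring) n : quotring (ideal_pow I n) :=
  invlim_fun x n.

Lemma ring_projE n r :
  @ring_proj R I n (quotring_pi (ideal_pow I n.+1) r) =
  quotring_pi (ideal_pow I n) r.
Proof. exact: quotmod_mapE. Qed.

Program Definition completion_of (r : R) : completion_ring :=
  @InvLim _ _ (@ring_proj R I) (fun n => quotring_pi (ideal_pow I n) r) _.
Next Obligation. by move=> r n; exact: ring_projE. Qed.

Program Definition completion_mul (x y : completion_ring) : completion_ring :=
  @InvLim _ _ (@ring_proj R I)
    (fun n => completion_coord x n * completion_coord y n) _.
Next Obligation.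
move=> x y n; rewrite /completion_coord -(invlimP x n) -(invlimP y n).
have [[r ->] [s ->]] := (quotring_repr (x n.+1), quotring_repr (y n.+1)).
by rewrite -quotring_piM !ring_projE quotring_piM.
Qed.

Let mulA : associative completion_mul.
Proof. by move=> x y z; apply: invlim_ext => n; exact: (@mulrA (quotring (ideal_pow I n))). Qed.
Let mulC : commutative completion_mul.
Proof. by move=> x y; apply: invlim_ext => n; exact: (@mulrC (quotring (ideal_pow I n))). Qed.
Let mul1 : left_id (completion_of 1) completion_mul.
Proof. by move=> x; apply: invlim_ext => n; exact: (@mul1r (quotring (ideal_pow I n))). Qed.
Let mulDl : left_distributive completion_mul +%R.
Proof. by move=> x y z; apply: invlim_ext => n; exact: (@mulrDl (quotring (ideal_pow I n))). Qed.
HB.instance Definition _ :=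
  GRing.Zmodule_isComPzRing.Build completion_ring mulA mulC mul1 mulDl.

End CompletionRing.

Section CompletionModule.
Variables (R : comPzRingType) (I : ideal R) (M : lmodType R).

(* Separate from invlim, which is an R-module: this type carries the module
   structure over the completed ring. *)
Definition completion : Type := invlim (@adic_proj R I M).
HB.instance Definition _ := GRing.Zmodule.on completion.

Lemma adic_projE n (x : M) :
  @adic_proj R I M n (\pi_(quotmod _) x) = \pi_(quotmod _) x.
Proof. exact: quotmod_mapE. Qed.

Program Definition completion_scale (r : completion_ring I) (x : completion) :
    completion :=
  @InvLim _ _ (@adic_proj R I M)
    (fun n => quot_act (completion_coord r n) (invlim_fun x n)) _.
Next Obligation.
move=> r x n; rewrite /completion_coord -(invlimP r n) -(invlimP x n).
have [s ->] := quotring_repr (r n.+1).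
have -> : x n.+1 = \pi_(quotmod _) (repr (x n.+1 : quotmod _)) by rewrite reprK.
by rewrite quot_actE ring_projE !adic_projE quot_actE.
Qed.

Let scaleA a b x :
  completion_scale a (completion_scale b x) = completion_scale (a * b) x.
Proof. by apply: invlim_ext => n; exact: quot_actA. Qed.
Let scale1 : left_id 1 completion_scale.
Proof. by move=> x; apply: invlim_ext => n; exact: quot_act1. Qed.
Let scaleDr : right_distributive completion_scale +%R.
Proof. by move=> a x y; apply: invlim_ext => n; exact: quot_actDr. Qed.
Let scaleDl x : {morph completion_scale^~ x : a b / a + b}.
Proof. by move=> a b; apply: invlim_ext => n; exact: quot_actDl. Qed.
HB.instance Definition _ := GRing.Zmodule_isLmodule.Build (completion_ring I)
  completion scaleA scale1 scaleDr scaleDl.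

End CompletionModule.

Section CompletionIdeals.
Variables (R : comPzRingType) (I : ideal R).

Definition ideal_ext (J : ideal R) : ideal (completion_ring I) :=
  @span _ (completion_ring I)^o [set x | exists r : R, J r /\ x = completion_of I r].

(* The kernel of R^ -> R / I (recall I^1 = I); for I = m maximal, R^ / ker is
   the residue field and this is the maximal ideal of R^. *)
Program Definition completion_ideal : ideal (completion_ring I) :=
  @Submodule _ (completion_ring I)^o [set x | completion_coord x 1%N = 0] _ _ _.
Next Obligation. by []. Qed.
Next Obligation.
move=> x y /= x0 y0; transitivity (completion_coord x 1%N + completion_coord y 1%N) => //.
by rewrite x0 y0 addr0.
Qed.
Next Obligation.
move=> r x /= x0; transitivity (completion_coord r 1%N * completion_coord x 1%N) => //.
by rewrite x0 mulr0.
Qed.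

End CompletionIdeals.

Definition associated_prime (A : comPzRingType) (N : lmodType A) (p : Spec A) :=
  exists x : N, forall r : A, p r <-> r *: x = 0.

Section KernelImage.
Variables (R : comPzRingType) (N N' : lmodType R) (g : {linear N -> N'}).

Program Definition ker_submodule : submodule N :=
  @Submodule R N [set x | g x = 0] _ _ _.
Next Obligation. by rewrite /= linear0. Qed.
Next Obligation. by move=> x y /= gx gy; rewrite linearD gx gy addr0. Qed.
Next Obligation. by move=> r x /= gx; rewrite linearZ /= gx scaler0. Qed.

Program Definition im_submodule : submodule N' :=
  @Submodule R N' (range g) _ _ _.
Next Obligation. by exists 0 => //; rewrite linear0. Qed.
Next Obligation.
by move=> _ _ [x _ <-] [y _ <-]; exists (x + y) => //; rewrite linearD.
Qed.
Next Obligation.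
by move=> r _ [x _ <-]; exists (r *: x) => //; rewrite linearZ.
Qed.

End KernelImage.

Program Definition restrict_submodule (R : comPzRingType) (N : lmodType R)
    (S T : submodule N) : submodule (submod_type S) :=
  @Submodule R (submod_type S) [set z | T (val z)] _ _ _.
Next Obligation. by move=> *; exact: submod0. Qed.
Next Obligation. by move=> R N S T x y; exact: submodD. Qed.
Next Obligation. by move=> R N S T r x; exact: submodZ. Qed.

Record cochain (R : comPzRingType) := Cochain {
  cobj :> nat -> lmodType R;
  cdiff : forall i, {linear cobj i -> cobj i.+1};
  cdiff2 : forall i x, cdiff i.+1 (cdiff i x) = 0 }.

Record cochain_map (R : comPzRingType) (C D : cochain R) := CochainMap {
  cmap :> forall i, {linear C i -> D i};
  cmapP : forall i x, cmap i.+1 (cdiff C i x) = cdiff D i (cmap i x) }.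

Section Cohomology.
Variable R : comPzRingType.
Implicit Types C D : cochain R.

Definition cocycles C i : submodule (C i) := ker_submodule (cdiff C i).

Definition coboundaries C i : submodule (C i) :=
  match i with
  | 0%N => zero_submodule (C 0%N)
  | j.+1 => im_submodule (cdiff C j)
  end.

Definition cohomology C i : lmodType R :=
  quotmod (restrict_submodule (cocycles C i) (coboundaries C i)).

Section Map.
Variables (C D : cochain R) (phi : cochain_map C D) (i : nat).

Lemma cmap_cocycles x : cocycles C i x -> cocycles D i (phi i x).
Proof. by rewrite /= -cmapP => ->; rewrite linear0. Qed.

Lemma cmap_coboundaries x : coboundaries C i x -> coboundaries D i (phi i x).
Proof.
case: i x => [x /= ->|j x /=]; first exact: linear0.
by move=> [y _ <-]; exists (phi j y) => //; rewrite cmapP.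
Qed.

Lemma cmap_restrict (z : submod_type (cocycles C i)) :
  restrict_submodule (cocycles C i) (coboundaries C i) z ->
  restrict_submodule (cocycles D i) (coboundaries D i)
    (submod_map cmap_cocycles z).
Proof. exact: cmap_coboundaries. Qed.

Definition cohomology_map : {linear cohomology C i -> cohomology D i} :=
  quotmod_map (g := submod_map cmap_cocycles) cmap_restrict.

End Map.
End Cohomology.

Section Torsion.
Variables (R : comPzRingType) (m : ideal R).

Program Definition torsion (N : lmodType R) : submodule N :=
  @Submodule R N [set x | exists k, forall r, ideal_pow m k r -> r *: x = 0] _ _ _.
Next Obligation. by move=> N; exists 0%N => r _; rewrite scaler0. Qed.
Next Obligation.
move=> N x y [k xk] [l yl]; exists (maxn k l) => r mr.
rewrite scalerDr xk ?yl ?addr0 //; apply: ideal_pow_le mr.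
  exact: leq_maxr.
exact: leq_maxl.
Qed.
Next Obligation.
move=> N s x [k xk]; exists k => r mr.
by rewrite scalerA mulrC -scalerA xk // scaler0.
Qed.

Lemma torsion_linear (N N' : lmodType R) (g : {linear N -> N'}) x :
  torsion N x -> torsion N' (g x).
Proof. by move=> [k xk]; exists k => r /xk rx; rewrite -linearZ rx linear0. Qed.

Definition torsion_obj (N : lmodType R) : lmodType R := submod_type (torsion N).

Definition torsion_map (N N' : lmodType R) (g : {linear N -> N'}) :
  {linear torsion_obj N -> torsion_obj N'} := submod_map (@torsion_linear N N' g).

Program Definition torsion_cochain (C : cochain R) : cochain R :=
  @Cochain R (fun i => torsion_obj (C i)) (fun i => torsion_map (cdiff C i)) _.
Next Obligation. by move=> C i x; apply: val_inj; exact: cdiff2. Qed.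

Program Definition torsion_cochain_map (C D : cochain R) (phi : cochain_map C D) :
    cochain_map (torsion_cochain C) (torsion_cochain D) :=
  @CochainMap R (torsion_cochain C) (torsion_cochain D)
    (fun i => torsion_map (phi i)) _.
Next Obligation. by move=> C D phi i x; apply: val_inj; exact: cmapP. Qed.

End Torsion.

Definition injective_module (R : comPzRingType) (E : lmodType R) :=
  forall (N N' : lmodType R) (j : {linear N -> N'}) (g : {linear N -> E}),
    injective j -> exists h : {linear N' -> E}, forall x, h (j x) = g x.

Record injective_resolution (R : comPzRingType) (N : lmodType R) := InjResolution {
  res_cochain :> cochain R;
  res_aug : {linear N -> res_cochain 0%N};
  res_injective : forall i, injective_module (res_cochain i);
  res_aug_inj : injective res_aug;
  res_exact0 : forall x, cdiff res_cochain 0%N x = 0 <-> range res_aug x;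
  res_exact : forall i x,
    cdiff res_cochain i.+1 x = 0 <-> range (cdiff res_cochain i) x }.

Record resolution_map (R : comPzRingType) (N N' : lmodType R) (g : {linear N -> N'})
    (E : injective_resolution N) (E' : injective_resolution N') := ResolutionMap {
  res_map :> cochain_map E E';
  res_mapP : forall x, res_map 0%N (res_aug E x) = res_aug E' (g x) }.

Section LocalCohomology.
Variables (R : comPzRingType) (m : ideal R).

Definition local_cohomology (N : lmodType R) (E : injective_resolution N) i :
    lmodType R :=
  cohomology (torsion_cochain m E) i.

Definition local_cohomology_map (N N' : lmodType R) (g : {linear N -> N'})
    (E : injective_resolution N) (E' : injective_resolution N')
    (phi : resolution_map g E E') i :
    {linear local_cohomology E i -> local_cohomology E' i} :=
  cohomology_map (torsion_cochain_map m phi) i.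

(* lim_n H^i_m(M / a^n M). Injective resolutions E n of M / a^n M and lifts
   phi n of the projections M / a^n.+1 M -> M / a^n M are chosen; the limit does
   not depend on these choices, up to isomorphism. *)
Definition formal_local_cohomology (a : ideal R) (M : lmodType R)
    (E : forall n, injective_resolution (adic_quotient a M n))
    (phi : forall n, resolution_map (@adic_proj R a M n) (E n.+1) (E n)) i :
    lmodType R :=
  invlim (fun n => local_cohomology_map (phi n) i).

End LocalCohomology.

(* Main.v *)
(* Let S = R^, f : R -> S, and p = Ann(x) with x in M^.  If V(aS + p) minus the
   closed point were disconnected, there would be ideals b and c of S, neither
   contained in the radical of aS + p, such that every prime over aS + p contains
   b or c and every prime over b + c contains m^.  The function equal to 0 on V(b)
   and to 1 on V(c) multiplies x into the ideal transform of every M^/a^n M^, and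
   its classes in H^1_m(M^/a^n M^) = H^1_m(M/a^n M) are compatible.  As
   lim H^1_m(M/a^n M) = 0, they vanish, so for each n some y_n in M^ represents
   this section modulo a^n M^ up to m-torsion.  By linear compactness of M^ a
   single y works for all n: powers of b multiply y, and powers of c multiply
   x - y, into a^n M^ up to powers of m.
   By Artin-Rees a^n M^ meets Sy in ay for large n.  If Ann(y) is contained in p,
   this puts b into the radical of aS + p; otherwise s y = 0 with s not in p, and
   the same argument for sx = s(x - y) puts c into that radical. *)

From HB Require Import structures.
Require Import Defs.
From mathcomp Require Import all_boot all_order all_algebra.
From mathcomp Require Import generic_quotient.
From mathcomp Require Import boolp classical_sets functions topology.

Set Implicit Arguments.
Unset Strict Implicit.
Unset Printing Implicit Defensive.

Import GRing.Theory.
Local Open Scope classical_set_scope.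
Local Open Scope ring_scope.
Local Open Scope quotient_scope.

(** The ideals b, c and the element x live over S, but the given resolutions are of the R-modules N
    = M/a^n M and come without an S-structure. So H^1_m(M/a^n M) and H^1_m(M^/a^n M^) are never
    compared as modules. Instead the section is read as an R-linear map from some m^k to N^ = M^/a^n
    M^, and such a map is a map h : m^k -> N plus multiplication by a single w in N^
    ([hom_completion_split]). Injectivity of E^0 turns h into an element e with r e = h(r), whose
    differential gives the class in H^1_m(N); the w-part is a global section and does not
    contribute. An element of N^ that m^k multiplies into N is an element of N plus torsion
    ([torsion_quotient_split]), so the class does not depend on the choice of (e, w). The splitting
    holds because homomorphisms into N are dense among those into N^, while Artin-Rees makes a
    homomorphism close to 0 a multiplication by an element close to 0. As S is an inverse limit by
    definition, its Noetherian property has to be proved first; this is done along the lines of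
    Cohen's theorem. *)

Local Notation span := Defs.span.

Arguments submod_set : simpl never.

(** * Spans, sums, colons and powers of ideals *)

Section SpanMembership.
Variables (A : comPzRingType) (V : lmodType A).
Implicit Types (S : submodule V) (G : set V).

Lemma subset_span G : G `<=` span G.
Proof. by move=> x Gx S; apply. Qed.

Lemma span_subP G S : span G `<=` S <-> G `<=` S.
Proof. by split=> [GS x /subset_span/GS|GS x]; last exact. Qed.

End SpanMembership.

Local Opaque Defs.span.

Section SubmoduleOperations.
Variables (A : comPzRingType) (V : lmodType A).
Implicit Types (S T : submodule V) (G : set V) (I J : ideal A).

Lemma span_nil : span [set` [::]] `<=` [set (0 : V)].
Proof. by apply: (iffRL (span_subP _ (zero_submodule V))). Qed.

Lemma mem_span (s : seq V) x : x \in s -> span [set` s] x.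
Proof. by move=> xs; apply: subset_span. Qed.

(** Closed with [Defined], as are the constructions below, so that membership unfolds by
    conversion. *)
Definition submod_cap S T : submodule V.
Proof.
exists (fun x => S x /\ T x).
- by split; exact: submod0.
- by move=> x y [Sx Tx] [Sy Ty]; split; exact: submodD.
- by move=> r x [Sx Tx]; split; exact: submodZ.
Defined.

Definition submod_colon S (r : A) : submodule V.
Proof.
exists (fun x => S (r *: x)).
- by rewrite scaler0; exact: submod0.
- by move=> x y Sx Sy; rewrite scalerDr; exact: submodD.
- by move=> t x Sx; rewrite scalerA mulrC -scalerA; exact: submodZ.
Defined.

Definition ideal_colon S (x : V) : ideal A.
Proof.
exists (fun r : A => S (r *: x)).
- by rewrite scale0r; exact: submod0.
- by move=> r t Sr St; rewrite scalerDl; exact: submodD.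
- by move=> t r Sr; rewrite -scalerA; exact: submodZ.
Defined.

(** The same module as [submodule_sum S T], but with membership given by a decomposition instead of
    a span; see [submodule_sumP]. *)
Definition submod_add S T : submodule V.
Proof.
exists (fun x => exists2 y, S y & T (x - y)).
- by exists 0; rewrite ?subr0; exact: submod0.
- move=> x y [x' Sx Tx] [y' Sy Ty]; exists (x' + y'); first exact: submodD.
  by rewrite opprD addrACA; exact: submodD.
- move=> r x [x' Sx Tx]; exists (r *: x'); first exact: submodZ.
  by rewrite -scalerBr; exact: submodZ.
Defined.

Lemma submod_addl S T : S `<=` submod_add S T.
Proof. by move=> x Sx; exists x => //; rewrite subrr; exact: submod0. Qed.

Lemma submod_addr S T : T `<=` submod_add S T.
Proof. by move=> x Tx; exists 0; [exact: submod0|rewrite subr0]. Qed.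

Lemma submodule_sumP S T x :
  submodule_sum S T x <-> exists2 y, S y & T (x - y).
Proof.
split.
  suff : submodule_sum S T `<=` submod_add S T by exact.
  by apply/span_subP => y [|]; [exact: submod_addl|exact: submod_addr].
move=> [y Sy Ty]; rewrite -[x](subrK y) [x - y + y]addrC.
by apply: submodD; apply: subset_span; [left|right].
Qed.

Lemma submodule_suml S T : S `<=` submodule_sum S T.
Proof. by move=> x Sx; apply: subset_span; left. Qed.

Lemma submodule_sumr S T : T `<=` submodule_sum S T.
Proof. by move=> x Sx; apply: subset_span; right. Qed.

Lemma submodule_sum_sub S T (U : submodule V) :
  S `<=` U -> T `<=` U -> submodule_sum S T `<=` U.
Proof. by move=> SU TU; apply/span_subP => x [/SU|/TU]. Qed.

(** The module S + I v. Keeping the ideal as a parameter gives the pair S + I v, S + A v to which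
    [artin_rees_weak] is applied. *)
Definition submod_adjoin S I (v : V) : submodule V.
Proof.
exists (fun x => exists2 r : A, I r & S (x - r *: v)).
- by exists 0; [exact: (@submod0 _ A^o)|rewrite scale0r subr0; exact: submod0].
- move=> x y [r Ir Sx] [t It Sy]; exists (r + t); first exact: (@submodD _ A^o).
  by rewrite scalerDl opprD addrACA; exact: submodD.
- move=> t x [r Ir Sx]; exists (t * r); first exact: (@submodZ _ A^o).
  by rewrite -scalerA -scalerBr; exact: submodZ.
Defined.

Lemma submod_adjoin_sub S I v : S `<=` submod_adjoin S I v.
Proof. by move=> x Sx; exists 0; [exact: (@submod0 _ A^o)|rewrite scale0r subr0]. Qed.

Lemma submod_adjoin_mem S I v r : I r -> submod_adjoin S I v (r *: v).
Proof. by move=> Ir; exists r; rewrite ?subrr //; exact: submod0. Qed.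

Lemma span_consP (v : V) (s : seq V) x :
  span [set` v :: s] x <-> exists r, span [set` s] (x - r *: v).
Proof.
split=> [|[r Hr]].
  pose T := submod_adjoin (span [set` s]) (full_submodule A^o) v.
  suff H : span [set` v :: s] `<=` T by move=> /H[r _ Hr]; exists r.
  apply/span_subP => y /=; rewrite in_cons => /predU1P[->|ys].
    by exists 1 => //; rewrite scale1r subrr; exact: submod0.
  by apply: submod_adjoin_sub; exact: mem_span.
rewrite -[x](subrK (r *: v)); apply: submodD; last first.
  by apply: submodZ; apply: mem_span; rewrite mem_head.
move: (x - _) Hr; apply/span_subP => y /= ys.
by apply: mem_span; rewrite in_cons ys orbT.
Qed.

Lemma fg_subP S :
  finitely_generated S <->
  exists s : seq V, (forall v, v \in s -> S v) /\ S `<=` span [set` s].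
Proof.
split=> [[s <-]|[s [sS Ss]]]; first by exists s; split=> // v; exact: mem_span.
by exists s; apply/seteqP; split=> //; apply/span_subP.
Qed.

Lemma ideal_smul_mem I S r x : I r -> S x -> ideal_smul I S (r *: x).
Proof. by move=> Ir Sx; apply: subset_span; exists r, x. Qed.

Lemma ideal_smul_subP I S T :
  ideal_smul I S `<=` T <-> forall r x, I r -> S x -> T (r *: x).
Proof.
split=> [IST r x Ir Sx|H]; first by apply: IST; exact: ideal_smul_mem.
by apply/span_subP => _ [r [x [Ir Sx ->]]]; exact: H.
Qed.

Lemma ideal_smul_mono I J S T :
  I `<=` J -> S `<=` T -> ideal_smul I S `<=` ideal_smul J T.
Proof.
by move=> IJ ST; apply/ideal_smul_subP => r x /IJ Jr /ST; exact: ideal_smul_mem.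
Qed.

Lemma ideal_smul_sub I S : ideal_smul I S `<=` S.
Proof. by apply/ideal_smul_subP => r x _; exact: submodZ. Qed.

Lemma ideal_smul_adjoin S I v :
  ideal_smul I (submod_adjoin S (full_submodule A^o) v) `<=` submod_adjoin S I v.
Proof.
apply/ideal_smul_subP => r x Ir [t _ Sx]; exists (r * t).
  by rewrite mulrC; exact: (@submodZ _ A^o).
by rewrite -scalerA -scalerBr; exact: submodZ.
Qed.

End SubmoduleOperations.

Section IdealPowers.
Variable A : comPzRingType.
Implicit Types I J : ideal A.

Lemma ideal_powM I i j r t :
  ideal_pow I i r -> ideal_pow I j t -> ideal_pow I (i + j) (r * t).
Proof.
move=> + It; suff : ideal_pow I i `<=` ideal_colon (ideal_pow I (i + j)) (t : A^o).
  exact.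
elim: i => [|i IHi]; first by move=> u _; exact: (@submodZ _ A^o).
apply/ideal_smul_subP => u x Iu /IHi Hx.
rewrite -[submod_set _ _]/(ideal_pow I _ ((u * x) * t)) -mulrA.
exact: (@ideal_smul_mem _ A^o).
Qed.

Lemma ideal_powX I r n : I r -> ideal_pow I n (r ^+ n).
Proof.
by move=> Ir; elim: n => [|n IHn] //; rewrite exprS; exact: (@ideal_smul_mem _ A^o).
Qed.

Lemma ideal_pow_mono I J n : I `<=` J -> ideal_pow I n `<=` ideal_pow J n.
Proof. by move=> IJ; elim: n => // n IHn; exact: ideal_smul_mono. Qed.

(** A product of i + j factors from I + J expands into terms with at least i factors from I or at
    least j from J. The induction on i + j peels off one factor and lowers i or j accordingly. *)
Lemma ideal_pow_add I J i j :
  ideal_pow (submodule_sum I J) (i + j)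
    `<=` submodule_sum (ideal_pow I i) (ideal_pow J j).
Proof.
have [n] := ubnP (i + j); elim: n i j => // n IHn [|i] [|j] ijn.
- by move=> x _; apply: submodule_suml.
- by move=> x _; apply: submodule_suml.
- by move=> x _; apply: submodule_sumr.
rewrite addSn; apply/ideal_smul_subP => r x /submodule_sumP[y Iy Jry] Hx.
rewrite -[r](subrK y) [r - y + y]addrC scalerDl; apply: submodD.
- have /submodule_sumP[z Iz Jz] : submodule_sum (ideal_pow I i) (ideal_pow J j.+1) x.
    by apply: IHn => //; rewrite -ltnS -addSn.
  rewrite -[x](subrK z) [x - z + z]addrC scalerDr; apply: submodD.
    by apply: submodule_suml; exact: ideal_smul_mem.
  by apply: submodule_sumr; exact: submodZ.
- have /submodule_sumP[z Iz Jz] : submodule_sum (ideal_pow I i.+1) (ideal_pow J j) x.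
    by apply: IHn; rewrite addSnnS //; move: ijn; rewrite addSn ltnS.
  rewrite -[x](subrK z) [x - z + z]addrC scalerDr; apply: submodD.
    by apply: submodule_suml; exact: submodZ.
  by apply: submodule_sumr; exact: ideal_smul_mem.
Qed.

Lemma ideal_pow_smulD (V : lmodType A) I i j (S : submodule V) :
  ideal_smul (ideal_pow I (i + j)) S
    `<=` ideal_smul (ideal_pow I i) (ideal_smul (ideal_pow I j) S).
Proof.
apply/ideal_smul_subP => r x Ir Sx; move: r Ir.
set T := ideal_smul (ideal_pow I j) S.
suff : ideal_pow I (i + j) `<=` ideal_colon (ideal_smul (ideal_pow I i) T) x by [].
elim: i => [r Ir|i IHi].
  suff : ideal_smul (ideal_pow I 0) T (1 *: (r *: x)) by rewrite scale1r.
  by do 2!apply: ideal_smul_mem => //.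
apply/ideal_smul_subP => t y It /IHi Hy.
suff : ideal_smul (ideal_pow I i.+1) T (t *: (y *: x)) by rewrite scalerA.
suff : ideal_smul (ideal_pow I i) T `<=`
  submod_colon (ideal_smul (ideal_pow I i.+1) T) t by exact.
apply/ideal_smul_subP => u z Iu Tz.
suff : ideal_smul (ideal_pow I i.+1) T ((t * u) *: z) by rewrite -scalerA.
by apply: ideal_smul_mem => //; exact: (@ideal_smul_mem _ A^o).
Qed.

Lemma ideal_powD_smul I i j :
  ideal_pow I (i + j) `<=` ideal_smul (ideal_pow I i) (ideal_pow I j).
Proof.
move=> r Ir.
have /ideal_pow_smulD : ideal_smul (ideal_pow I (i + j)) (full_submodule A^o) r.
  by rewrite -[r]mulr1; exact: (@ideal_smul_mem _ A^o).
apply: ideal_smul_mono => //; apply/ideal_smul_subP => a b Ia _.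
by rewrite /GRing.scale /= mulrC; exact: (@submodZ _ A^o).
Qed.

Lemma ideal_pow_smul I J n r t :
  ideal_pow I n r -> ideal_pow J n t -> ideal_pow (ideal_smul I J) n (r * t).
Proof.
elim: n r t => [|n IHn] // r t.
have @D : ideal A.
{ apply: (@Submodule A A^o (fun r : A => forall t : A, ideal_pow J n.+1 t ->
    ideal_pow (ideal_smul I J) n.+1 (r * t))).
  - by move=> u _; rewrite mul0r; exact: (@submod0 _ A^o).
  - by move=> u v Du Dv w Jw; rewrite mulrDl; apply: (@submodD _ A^o); [exact: Du|exact: Dv].
  - by move=> u v Dv w Jw; rewrite -mulrA; apply: (@submodZ _ A^o); exact: Dv. }
suff HD : ideal_pow I n.+1 `<=` D by move=> Ir Jt; exact: HD.
apply/ideal_smul_subP => u r' Iu Ir' w Jw.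
suff HJ : ideal_pow J n.+1 `<=`
  @ideal_colon A A^o (ideal_pow (ideal_smul I J) n.+1) (u * r').
  by rewrite mulrC; exact: HJ.
apply/ideal_smul_subP => v t' Jv Jt'.
rewrite -[submod_set _ _]/(ideal_pow (ideal_smul I J) n.+1 ((v * t') * (u * r'))).
rewrite mulrACA [v * u]mulrC [t' * r']mulrC.
by apply: (@ideal_smul_mem _ A^o); [exact: (@ideal_smul_mem _ A^o)|exact: IHn].
Qed.

(** Splitting off one generator t, the power k + n of (t) + (s) lies in (t^k) + (s)^n. *)
Lemma span_pow_sub (s : seq A^o) J :
  (forall t, t \in s -> exists n, J (t ^+ n)) ->
  exists n, ideal_pow (span [set` s]) n `<=` J.
Proof.
elim: s => [|t s IHs] sJ.
  exists 1%N; apply/ideal_smul_subP => r x /span_nil /= -> _.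
  by rewrite scale0r; exact: submod0.
have [|n Jn] := IHs; first by move=> u us; apply: sJ; rewrite in_cons us orbT.
have [k Jk] : exists n, J (t ^+ n) by apply: sJ; rewrite mem_head.
exists (k + n)%N => x Hx.
pose It : ideal A := span [set` [:: t : A^o]].
have {}Hx : ideal_pow (submodule_sum It (span [set` s])) (k + n) x.
  apply: ideal_pow_mono Hx; apply/span_subP => y /=.
  rewrite in_cons => /predU1P[->|ys].
    by apply: submodule_suml; apply: mem_span; rewrite mem_head.
  by apply: submodule_sumr; exact: mem_span.
have := ideal_pow_add Hx; apply: (submodule_sum_sub _ Jn).
suff H j z : ideal_pow It j z -> exists r, z = r * t ^+ j.
  by move=> z /H[r ->]; exact: (@submodZ _ A^o).
elim: j z => [|j IHj] z; first by move=> _; exists z; rewrite mulr1.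
pose P : ideal A := submod_adjoin (zero_submodule A^o) (full_submodule A^o) (t ^+ j.+1).
suff /(_ z) : ideal_pow It j.+1 `<=` P.
  by move=> H /H[r _ /= /eqP]; rewrite subr_eq0 => /eqP ->; exists r.
apply/ideal_smul_subP => r x' /span_consP[u /span_nil /= /eqP].
rewrite subr_eq0 => /eqP -> /IHj[w ->]; exists (u * w) => //=.
apply/eqP; rewrite subr_eq0; apply/eqP.
by rewrite /GRing.scale /= exprS mulrACA.
Qed.

End IdealPowers.

(** * Noetherian modules and the Artin-Rees lemma *)

Section NoetherianModules.
Variables (A : comPzRingType) (V : lmodType A).
Implicit Types (S T : submodule V) (I : ideal A).

Definition noetherian_module := forall S, finitely_generated S.

Lemma nondecreasing_submodules (S_ : nat -> submodule V) n k :
  (forall n, S_ n `<=` S_ n.+1) -> (n <= k)%N -> S_ n `<=` S_ k.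
Proof.
by move=> S_incr /subnK <-; elim: (k - n)%N => // d IHd x /IHd /S_incr.
Qed.

Definition submod_bigcup (S_ : nat -> submodule V)
  (S_incr : forall n, S_ n `<=` S_ n.+1) : submodule V.
Proof.
exists (fun x => exists n, S_ n x).
- by exists 0%N; exact: submod0.
- move=> x y [n Sx] [k Sy]; exists (maxn n k); apply: submodD.
    by apply: nondecreasing_submodules Sx => //; exact: leq_maxl.
  by apply: nondecreasing_submodules Sy => //; exact: leq_maxr.
- by move=> r x [n Sx]; exists n; exact: submodZ.
Defined.

Lemma noetherian_acc (S_ : nat -> submodule V) :
  noetherian_module -> (forall n, S_ n `<=` S_ n.+1) ->
  exists n, forall k, S_ k `<=` S_ n.
Proof.
move=> noethV S_incr.
have le n k := @nondecreasing_submodules S_ n k S_incr.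
have /fg_subP[s [sS Ss]] := noethV (submod_bigcup S_incr).
suff [n Hn] : exists n, forall v, v \in s -> S_ n v.
  exists n => k x Skx; have {Skx} : span [set` s] x by apply: Ss; exists k.
  by move: x; apply/span_subP.
elim: s sS {Ss} => [|v s IHs] sS; first by exists 0%N.
have [|n Hn] := IHs; first by move=> u us; apply: sS; rewrite in_cons us orbT.
have [k Hk] : submod_bigcup S_incr v by apply: sS; rewrite mem_head.
exists (maxn n k) => u; rewrite in_cons => /predU1P[->|us].
  by apply: le Hk; exact: leq_maxr.
by apply: le (Hn u us); exact: leq_maxl.
Qed.

Lemma noetherian_max (P : submodule V -> Prop) S :
  noetherian_module -> P S ->
  exists T, P T /\ forall U, P U -> T `<=` U -> U `<=` T.
Proof.
move=> noethV PS; apply: contrapT => noT.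
have H (T : {T | P T}) : {U : {U | P U} | sval T `<=` sval U /\ ~ (sval U `<=` sval T)}.
  apply: cid; case: T => T PT /=; apply: contrapT => H; apply: noT.
  exists T; split=> // U PU TU; apply: contrapT => UT; apply: H.
  by exists (exist _ U PU).
have [f [_ fS]] := dependent_choice H (exist _ S PS).
have [n Hn] := noetherian_acc noethV (fun n => (fS n).1).
exact: (fS n).2 (Hn n.+1).
Qed.

(** The coefficients at [v] of the elements of T form an ideal. Lifts to T of its generators,
    together with generators of the part of T inside the span of s, generate T. *)
Lemma noetherian_span (s : seq V) T :
  noetherian A -> T `<=` span [set` s] -> finitely_generated T.
Proof.
move=> noethA; elim: s T => [|v s IHs] T Ts.
  apply/fg_subP; exists [::]; split=> // x /Ts /span_nil ->; exact: submod0.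
have @I : ideal A.
{ exists (fun r : A => exists2 t, T t & span [set` s] (t - r *: v)).
  - by exists 0; rewrite ?scale0r ?subr0; exact: submod0.
  - move=> r r' [t Tt st] [t' Tt' st']; exists (t + t'); first exact: submodD.
    by rewrite scalerDl opprD addrACA; exact: submodD.
  - move=> r' r [t Tt st]; exists (r' *: t); first exact: submodZ.
    by rewrite -scalerA -scalerBr; exact: submodZ. }
have /fg_subP[gs [gsI Igs]] := noethA I.
have [|t Ht] := @choice A V (fun r t => I r -> T t /\ span [set` s] (t - r *: v)).
  move=> r; have [[t Tt st]|nI] := pselect (I r); first by exists t.
  by exists 0.
have /fg_subP[s' [s'T Ts']] : finitely_generated (submod_cap T (span [set` s])).
  by apply: IHs => x [].
apply/fg_subP; exists (map t gs ++ s'); split.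
  move=> x; rewrite mem_cat => /orP[/mapP[r /gsI /Ht[Tt _] ->]|/s'T[]] //.
move=> x Tx; have /span_consP[r sxr] := Ts x Tx.
have @U : ideal A.
{ exists (fun r : A => exists2 y, span [set` map t gs] y & span [set` s] (y - r *: v)).
  - by exists 0; rewrite ?scale0r ?subr0; exact: submod0.
  - move=> a b [y Ty sy] [z Tz sz]; exists (y + z); first exact: submodD.
    by rewrite scalerDl opprD addrACA; exact: submodD.
  - move=> b a [y Ty sy]; exists (b *: y); first exact: submodZ.
    by rewrite -scalerA -scalerBr; exact: submodZ. }
have {Igs}[y yt sy] : U r.
  suff H : span [set` gs] `<=` U by apply/H/Igs; exists x.
  apply/span_subP => a ags; exists (t a).
    by apply: mem_span; exact: map_f.
  by case: (Ht _ (gsI _ ags)).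
have Ty : T y.
  by move: y yt {sy}; apply/span_subP => _ /mapP[a /gsI /Ht[Ta _] ->].
rewrite -[x](subrK y); apply: submodD.
  have : span [set` s'] (x - y).
    apply: Ts'; split; first exact: submodB.
    suff -> : x - y = (x - r *: v) - (y - r *: v) by exact: submodB.
    by rewrite opprB addrA subrK.
  by move: (x - y); apply/span_subP => z zs; apply: mem_span; rewrite mem_cat; apply/orP; right.
by move: y yt {sy Ty}; apply/span_subP => z zs; apply: mem_span; rewrite mem_cat; apply/orP; left.
Qed.

Lemma noetherian_fg :
  noetherian A -> finitely_generated (full_submodule V) -> noetherian_module.
Proof.
move=> noethA [s fs] S; apply: (@noetherian_span s) => // x _.
by have : full_submodule V x by []; rewrite -fs.
Qed.

End NoetherianModules.

Lemma fg_surj (A : comPzRingType) (V W : lmodType A) (g : {linear V -> W}) :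
  (forall y, exists x, y = g x) -> finitely_generated (full_submodule V) ->
  finitely_generated (full_submodule W).
Proof.
move=> gsurj [s fs]; apply/fg_subP; exists (map g s); split=> // y _.
have [x ->] := gsurj y.
have : full_submodule V x by []. rewrite -fs => {y}.
have @T : submodule V.
{ exists (fun x => span [set` map g s] (g x)).
  - by rewrite linear0; exact: submod0.
  - by move=> a b sa sb; rewrite linearD; exact: submodD.
  - by move=> a b sb; rewrite linearZ; exact: submodZ. }
suff : span [set` s] `<=` T by apply.
by apply/span_subP => z zs; apply: mem_span; exact: map_f.
Qed.

Section ArtinRees.
Variables (A : comPzRingType) (V : lmodType A).
Hypotheses (noethA : noetherian A) (noethV : noetherian_module V).
Implicit Types (N S T : submodule V) (I : ideal A).

(* Take Q maximal with N :&: Q contained in N0. For t in I the chain of the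
   (Q : t^i) stabilises at some i, and then Q + t^i V still meets N in N0. *)
Lemma artin_rees_weak I N0 N :
  N0 `<=` N -> ideal_smul I N `<=` N0 ->
  exists n, forall z, ideal_smul (ideal_pow I n) (full_submodule V) z -> N z -> N0 z.
Proof.
move=> N0N IN.
have [Q [[N0Q QN] Qmax]] := @noetherian_max _ _
  (fun Q => N0 `<=` Q /\ forall z, Q z -> N z -> N0 z) N0 noethV
  (conj (fun _ h => h) (fun _ h _ => h)).
have @J : ideal A.
{ exists (fun r : A => forall x : V, Q (r *: x)).
  - by move=> x; rewrite scale0r; exact: submod0.
  - by move=> r t Qr Qt x; rewrite scalerDl; exact: submodD.
  - by move=> t r Qr x; rewrite -scalerA; exact: submodZ. }
have nilp (t : A) : I t -> exists n, J (t ^+ n).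
  move=> It.
  have [|n Hn] := @noetherian_acc _ _ (fun i => submod_colon Q (t ^+ i)) noethV.
    move=> n x Hx; rewrite -[submod_set _ _]/(Q (t ^+ n.+1 *: x)).
    by rewrite exprS -scalerA; exact: submodZ.
  exists n => x.
  have @tV : submodule V.
  { exists (fun y => exists x, y = t ^+ n *: x).
    - by exists 0; rewrite scaler0.
    - by move=> _ _ [y ->] [z ->]; exists (y + z); rewrite scalerDr.
    - by move=> r _ [y ->]; exists (r *: y); rewrite !scalerA mulrC. }
  apply: (Qmax (submodule_sum Q tV)); last first.
  - by apply: submodule_sumr; exists x.
  - exact: submodule_suml.
  split=> [z /N0Q|z /submodule_sumP[q Qq [u zqu]] Nz]; first exact: submodule_suml.
  apply: QN => //.
  have Qtz : Q (t *: z) by apply/N0Q/IN; exact: ideal_smul_mem.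
  have Qu : submod_colon Q (t ^+ n) u.
    apply: (Hn n.+1); rewrite -[submod_set _ _]/(Q (t ^+ n.+1 *: u)).
    by rewrite exprS -scalerA -zqu scalerBr; apply: submodB => //; exact: submodZ.
  by rewrite -[z](subrK q); apply: submodD => //; rewrite zqu.
have /fg_subP[s [sI Is]] := noethA I.
have [n Hn] := @span_pow_sub _ s J (fun t ts => nilp t (sI t ts)).
exists n => z Hz Nz; apply: QN => //; move: z Hz {Nz}; apply/ideal_smul_subP => r x Ir _.
have /Hn : ideal_pow (span [set` s]) n r by apply: ideal_pow_mono Ir.
exact.
Qed.

(** The weak form for the ideal I^q, with N0 = I^q N. Its n-th power contains I^(q n). *)
Lemma artin_rees I N q :
  exists n, forall z, ideal_smul (ideal_pow I n) (full_submodule V) z -> N z ->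
    ideal_smul (ideal_pow I q) N z.
Proof.
have [|n Hn] := @artin_rees_weak (ideal_pow I q) (ideal_smul (ideal_pow I q) N) N _ (fun _ h => h).
  exact: ideal_smul_sub.
exists (q * n)%N => z Hz; apply: Hn; apply: ideal_smul_mono Hz => //.
elim: n => [|n IHn] // r; rewrite mulnS => /ideal_powD_smul.
exact: ideal_smul_mono.
Qed.

(** Krull's intersection theorem for V/T. Weak Artin-Rees for T + I z inside T + A z puts z - y into
    T + I z, hence (1 - t) z into T for some t in I, and 1 - t is a unit. *)
Lemma submodule_closed I T z :
  (forall t, I t -> exists u, u * (1 - t) = 1) ->
  (forall n, exists2 y, T y & ideal_smul (ideal_pow I n) (full_submodule V) (z - y)) ->
  T z.
Proof.
move=> Iu Hz.
have [||n Hn] := @artin_rees_weak I (submod_adjoin T I z)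
    (submod_adjoin T (full_submodule A^o) z).
- by move=> x [r Ir Hx]; exists r.
- exact: ideal_smul_adjoin.
have [y Ty /Hn] := Hz n; case.
  rewrite -opprB; apply: submodN; exists (-1) => //.
  by rewrite scaleN1r opprK subrK.
move=> t It Tt; have [u Hu] := Iu t It.
rewrite -[z]scale1r -Hu -scalerA; apply: submodZ.
rewrite scalerBl scale1r.
suff -> : z - t *: z = (z - y - t *: z) + y by exact: submodD.
by rewrite addrAC subrK.
Qed.

End ArtinRees.

(** * Primes, radicals and units of local rings *)

Section Krull.
Variables (A : comPzRingType).
Hypotheses (noethA : noetherian A).
Implicit Types (I J : ideal A).

(** An ideal maximal among those that contain J and no power of t is prime: t^n = r x and t^k = u y
    modulo Q would give a power of t in Q as soon as Q contains x y. *)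
Lemma prime_avoiding J t :
  (forall n, ~ J (t ^+ n)) -> exists q : Spec A, J `<=` q /\ ~ q t.
Proof.
move=> Jt.
have [Q [[JQ Qt] Qmax]] := @noetherian_max _ _
  (fun Q : ideal A => J `<=` Q /\ forall n, ~ Q (t ^+ n)) J noethA
  (conj (fun _ h => h) Jt).
have Qadj x : ~ Q x -> exists n r, Q (t ^+ n - r * x).
  move=> nQx; apply: contrapT => H; apply: nQx.
  pose F : ideal A := full_submodule A^o.
  apply: (Qmax (@submod_adjoin A A^o Q F x)).
  - split=> [y /JQ|n [r _ Hr]]; first exact: submod_adjoin_sub.
    by apply: H; exists n, r.
  - exact: submod_adjoin_sub.
  - by have := @submod_adjoin_mem _ A^o Q F x 1 Logic.I; rewrite scale1r.
have Q1 : ~ Q 1 by have := Qt 0%N; rewrite expr0.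
have Qmul x y : Q (x * y) -> Q x \/ Q y.
  move=> Qxy; apply: contrapT => /not_orP[/Qadj[n [r Hr]] /Qadj[k [u Hu]]].
  apply: (Qt (n + k)%N).
  suff -> : t ^+ (n + k) = t ^+ k *: ((t ^+ n - r * x : A^o))
     + (r * x) *: (t ^+ k - u * y : A^o) + (r * u) *: (x * y : A^o).
    by apply: submodD; [apply: submodD|]; exact: (@submodZ _ A^o).
  rewrite /GRing.scale /= !mulrBr exprD mulrACA addrA subrK.
  by rewrite [t ^+ k * (r * x)]mulrC subrK mulrC.
exists (PrimeIdeal Q1 Qmul); split=> // tq.
by apply: (Qt 1%N); rewrite expr1.
Qed.

Lemma radical_pow I J :
  (forall q : Spec A, J `<=` q -> I `<=` q) -> exists n, ideal_pow I n `<=` J.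
Proof.
move=> IJ; have /fg_subP[s [sI Is]] := noethA I.
have [|n Hn] := @span_pow_sub _ s J.
  move=> t /sI It; apply: contrapT => /forallNP Jt.
  by have [q [/IJ Iq]] := prime_avoiding Jt; apply; exact: Iq.
by exists n => r Ir; apply: Hn; apply: ideal_pow_mono Ir.
Qed.

End Krull.

(** The ascending chain condition, instead of Zorn's lemma, yields a maximal ideal over a non-unit;
    it must be m. *)
Lemma local_ring_unit (A : comPzRingType) (m : ideal A) (r : A) :
  noetherian A -> local_ring m -> ~ m r -> exists u, u * r = 1.
Proof.
move=> noethA [_ m_uniq] mr; apply: contrapT => nr.
pose rA : ideal A := @submod_adjoin A A^o (zero_submodule A^o) (full_submodule A^o) r.
have [Q [[rQ Q1] Qmax]] := @noetherian_max _ _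
  (fun Q : ideal A => rA `<=` Q /\ ~ Q 1) rA noethA (conj (fun _ h => h)
    (fun h => match h with ex_intro2 u _ hu => nr (ex_intro _ u (esym (subr0_eq hu))) end)).
have Q_maximal : maximal_ideal Q.
  split=> // I QI I1; apply/seteqP; split=> //; apply: Qmax => //; split=> //.
  by move=> x /rQ/QI.
apply: mr; rewrite -(m_uniq Q Q_maximal); apply: rQ.
by have := @submod_adjoin_mem _ A^o (zero_submodule A^o) (full_submodule A^o) r 1 Logic.I;
  rewrite scale1r.
Qed.

(** * Expansions in finitely many generators *)

Section Combinations.
Variables (A : comPzRingType) (V : lmodType A).
Implicit Types (s : seq V) (J : ideal A).

Lemma span_sum s x : span [set` s] x ->
  exists c : 'I_(size s) -> A, x = \sum_i c i *: s`_i.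
Proof.
have @T : submodule V.
{ exists (fun x => exists c : 'I_(size s) -> A, x = \sum_i c i *: s`_i).
  - by exists (fun=> 0); rewrite big1 // => i _; rewrite scale0r.
  - move=> _ _ [c ->] [d ->]; exists (fun i => c i + d i).
    by rewrite -big_split; apply: eq_bigr => i _; rewrite scalerDl.
  - move=> r _ [c ->]; exists (fun i => r * c i).
    by rewrite scaler_sumr; apply: eq_bigr => i _; rewrite scalerA. }
suff H : span [set` s] `<=` T by move=> /H.
apply/span_subP => y /= /(nthP 0)[i ilt <-].
exists (fun j => (j == i :> nat)%:R).
rewrite (bigD1 (Ordinal ilt)) //= eqxx scale1r big1 ?addr0 // => j.
by rewrite -val_eqE /= => /negbTE ->; rewrite scale0r.
Qed.

Lemma ideal_smul_span_sum J s x : ideal_smul J (span [set` s]) x ->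
  exists c : 'I_(size s) -> A, (forall i, J (c i)) /\ x = \sum_i c i *: s`_i.
Proof.
have @T : submodule V.
{ exists (fun x => exists c : 'I_(size s) -> A,
    (forall i, J (c i)) /\ x = \sum_i c i *: s`_i).
  - exists (fun=> 0); split=> [i|]; first exact: (@submod0 _ A^o).
    by rewrite big1 // => i _; rewrite scale0r.
  - move=> _ _ [c [Jc ->]] [d [Jd ->]]; exists (fun i => c i + d i).
    split=> [i|]; first exact: (@submodD _ A^o).
    by rewrite -big_split; apply: eq_bigr => i _; rewrite scalerDl.
  - move=> r _ [c [Jc ->]]; exists (fun i => r * c i).
    split=> [i|]; first exact: (@submodZ _ A^o).
    by rewrite scaler_sumr; apply: eq_bigr => i _; rewrite scalerA. }
suff H : ideal_smul J (span [set` s]) `<=` T by move=> /H.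
apply/ideal_smul_subP => r y Jr /span_sum[c ->]; exists (fun i => r * c i).
split=> [i|]; first by rewrite mulrC; exact: (@submodZ _ A^o).
by rewrite scaler_sumr; apply: eq_bigr => i _; rewrite scalerA.
Qed.

(** Expanding the increments of u instead of its terms makes the coefficient sequences Cauchy as
    well, so that limits can be taken coefficientwise. *)
Lemma telescope (J : nat -> ideal A) s (u : nat -> V) :
  u 0%N = 0 -> (forall j, ideal_smul (J j) (span [set` s]) (u j.+1 - u j)) ->
  exists c : nat -> 'I_(size s) -> A,
    [/\ forall i, c 0%N i = 0, forall j i, J j (c j.+1 i - c j i)
      & forall j, u j = \sum_i c j i *: s`_i].
Proof.
move=> u0 /(fun H j => ideal_smul_span_sum (H j)) /choice[d dP].
exists (fun j i => \sum_(k < j) d k i); split=> [i|j i|j].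
- by rewrite big_ord0.
- by rewrite big_ord_recr /= addrAC subrr add0r; exact: (dP j).1.
- elim: j => [|j IHj].
    by rewrite u0 big1 // => i _; rewrite big_ord0 scale0r.
  rewrite -[u j.+1](subrK (u j)) (dP j).2 IHj -big_split; apply: eq_bigr => i _.
  by rewrite big_ord_recr /= scalerDl addrC.
Qed.

End Combinations.

(** * Completions *)

Section FilteredLimits.
Variables (R : comPzRingType) (V : lmodType R) (F : nat -> submodule V).
Variable pr : forall n, {linear quotmod (F n.+1) -> quotmod (F n)}.
Local Notation lim := (@invlim R (fun n => quotmod (F n) : lmodType R) pr).
Hypothesis prE : forall n x, pr n (\pi_(quotmod (F n.+1)) x) = \pi_(quotmod (F n)) x.

(** The filtration F is arbitrary so that one statement serves R with F n = I^n and M with F n = I^n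
    M. *)
Lemma invlim_of_cauchy (u : nat -> V) : (forall n, F n (u n.+1 - u n)) ->
  exists x : lim, forall n, x n = \pi_(quotmod (F n)) (u n).
Proof.
move=> Fu.
have H n : pr n (\pi_(quotmod (F n.+1)) (u n.+1)) = \pi_(quotmod (F n)) (u n).
  by rewrite prE; apply/quotmodP.
by exists (InvLim H).
Qed.

Lemma invlim_cauchy (x : lim) : exists u : nat -> V,
  (forall n, x n = \pi_(quotmod (F n)) (u n)) /\ forall n, F n (u n.+1 - u n).
Proof.
exists (fun n => repr (x n)); split=> [n|n]; first by rewrite reprK.
by apply/quotmodP; rewrite -prE !reprK; exact: (invlimP x n).
Qed.

Lemma invlim_complete (x : nat -> lim) :
  (forall n, x n.+1 n = x n n) -> exists y : lim, forall n, y n = x n n.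
Proof.
move=> Hx; have H n : pr n (x n.+1 n.+1) = x n n.
  by rewrite -(Hx n); exact: (invlimP (x n.+1) n).
by exists (InvLim H).
Qed.

Lemma invlim_le (x : lim) n k u :
  (n <= k)%N -> x k = \pi_(quotmod (F k)) u -> x n = \pi_(quotmod (F n)) u.
Proof.
move=> /subnK <-; elim: (k - n)%N => // d IHd.
by rewrite addSn => Hd; apply: IHd; rewrite -prE -Hd; exact: (esym (invlimP x _)).
Qed.

(* A representing sequence that vanishes up to the index where x does. *)
Lemma invlim_cauchy0 (x : lim) l : x l = 0 ->
  exists u : nat -> V, [/\ forall n, (n <= l)%N -> u n = 0,
    forall n k, (n <= k)%N -> x n = \pi_(quotmod (F n)) (u k)
    & forall n, F (maxn n l) (u n.+1 - u n)].
Proof.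
move=> xl; have [u [xu Fu]] := invlim_cauchy x.
have pi0 : \pi_(quotmod (F l)) 0 = 0 by rewrite -[RHS](subrr (\pi_(quotmod (F l)) 0)) -quotmod_piB subrr.
exists (fun n => if (n <= l)%N then 0 else u n); split=> [n -> //|n k nk|n].
- case: leqP => kl; last exact: (invlim_le nk (xu k)).
  by apply: (invlim_le (leq_trans nk kl)); rewrite xl pi0.
- case: ltngtP => nl.
  + by rewrite subrr; exact: submod0.
  + exact: Fu.
  + rewrite subr0 -[u n.+1](subrK (u n)); apply: submodD; first exact: Fu.
    by rewrite nl -[u l]subr0; apply/quotmodP; rewrite -xu xl pi0.
Qed.

End FilteredLimits.

Section CompletionOfRing.
Variables (R : comPzRingType) (I : ideal R).
Local Notation S := (completion_ring I).
Implicit Types (x y : S) (r : R).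

Lemma quotring_pi_eq n r t :
  quotring_pi (ideal_pow I n) r = quotring_pi (ideal_pow I n) t <-> ideal_pow I n (r - t).
Proof. by split=> /quotmodP. Qed.

Lemma quotring_pi_eq0 n r : quotring_pi (ideal_pow I n) r = 0 <-> ideal_pow I n r.
Proof.
have <- : quotring_pi (ideal_pow I n) 0 = 0.
  by apply: (addrI (quotring_pi (ideal_pow I n) 0)); rewrite -quotring_piD !addr0.
by rewrite quotring_pi_eq subr0.
Qed.

Lemma completion_ring_ext x y :
  (forall n : nat, completion_coord x n = completion_coord y n) -> x = y.
Proof. exact: invlim_ext. Qed.

Lemma completion_ofB : {morph completion_of I : r t / r - t}.
Proof. by move=> r t; apply: completion_ring_ext => n; exact: quotmod_piB. Qed.

Lemma completion_ofM : {morph completion_of I : r t / r * t}.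
Proof. by move=> r t; apply: completion_ring_ext => n; exact: quotring_piM. Qed.

HB.instance Definition _ :=
  GRing.isZmodMorphism.Build R S (completion_of I) completion_ofB.
HB.instance Definition _ :=
  GRing.isMonoidMorphism.Build R S (completion_of I) (erefl, completion_ofM).

(** This filtration gives the topology of S. For n = 1 membership is convertible to membership in
    [completion_ideal]. *)
Definition completion_ker (n : nat) : ideal S.
Proof.
apply: (@Submodule S S^o (fun x : S => completion_coord x n = 0)).
- by [].
- by move=> x y; rewrite -[completion_coord (x + y) n]/(completion_coord x n + completion_coord y n)
    => -> ->; rewrite addr0.
- move=> r x x0; transitivity (completion_coord r n * completion_coord x n) => //.
  by rewrite x0 mulr0.
Defined.

Lemma completion_ker_of n r : completion_ker n (completion_of I r) <-> ideal_pow I n r.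
Proof. exact: quotring_pi_eq0. Qed.

Lemma completion_kerB n x y :
  completion_ker n (x - y) <-> completion_coord x n = completion_coord y n.
Proof.
rewrite -[submod_set _ _]/(completion_coord x n - completion_coord y n = 0).
by split=> [/eqP|->]; rewrite ?subr_eq0 ?subrr // => /eqP.
Qed.

Lemma completion_ring_separated x : (forall n, completion_ker n x) -> x = 0.
Proof. by move=> Hx; apply: completion_ring_ext => n; exact: Hx. Qed.

Lemma completion_ring_cauchy (u : nat -> R) :
  (forall n, ideal_pow I n (u n.+1 - u n)) ->
  exists x, forall n, completion_coord x n = quotring_pi (ideal_pow I n) (u n).
Proof.
move=> Iu; have [x Hx] := @invlim_of_cauchy R R^o (ideal_pow I) (@ring_proj R I)
  (@ring_projE R I) u Iu.
by exists x.
Qed.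

Lemma completion_kerS n x : completion_ker n.+1 x -> completion_ker n x.
Proof.
by move=> xn; rewrite -[submod_set _ _]/(invlim_fun x n = 0) -invlimP [invlim_fun _ _]xn linear0.
Qed.

Lemma completion_ring_complete (x : nat -> S) :
  (forall n, completion_ker n (x n.+1 - x n)) ->
  exists y, forall n, completion_ker n (y - x n).
Proof.
move=> Hx; have [|y Hy] := @invlim_complete R R^o (ideal_pow I) (@ring_proj R I) x.
  by move=> n; apply/completion_kerB.
by exists y => n; apply/completion_kerB; exact: Hy.
Qed.

Lemma completion_ring_approx x n : exists r, completion_ker n (x - completion_of I r).
Proof.
by have [r xr] := quotring_repr (completion_coord x n); exists r; apply/completion_kerB.
Qed.

Lemma ideal_powS_span n k (s : seq R^o) : span [set` s] = ideal_pow I n :> set R ->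
  ideal_pow I (k + n) `<=` ideal_smul (ideal_pow I k) (span [set` s]).
Proof.
by move=> sn r /ideal_powD_smul; apply: ideal_smul_mono => //; rewrite sn.
Qed.

(** An element of the kernel is represented by a sequence in I^n; its increments are expanded in the
    generators of I^n and the coefficients converge. *)
Lemma completion_ker_span n (s : seq R^o) : span [set` s] = ideal_pow I n :> set R ->
  completion_ker n `<=` span [set` map (completion_of I : R^o -> S^o) s].
Proof.
move=> sn x x0; have [u [u0 xu Fu]] := @invlim_cauchy0 R R^o (ideal_pow I) (@ring_proj R I)
  (@ring_projE R I) x n x0.
have [||c [c0 Fc uc]] := @telescope _ R^o (fun k => ideal_pow I (k - n)%N) s u.
- exact: u0.
- move=> k; apply: (ideal_powS_span sn); apply: ideal_pow_le (Fu k).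
  by rewrite maxnC maxnE addnC.
(* Using up I^n for the generators leaves the k-th increments of the coefficients in I^(k - n) only.
   So level k of the limit is read at index k + n. *)
have [|rho Hrho] := @choice 'I_(size s) S
  (fun i x => forall k, completion_coord x k = quotring_pi (ideal_pow I k) (c (k + n)%N i)).
  move=> i; apply: completion_ring_cauchy => k; have := Fc (k + n)%N i.
  by rewrite addnK.
have -> : x = \sum_i rho i * completion_of I s`_i.
  apply: completion_ring_ext => k.
  have -> : completion_coord x k = quotring_pi (ideal_pow I k) (u (k + n)%N).
    by apply: xu; exact: leq_addr.
  have coord_sum (t : seq 'I_(size s)) (F : 'I_(size s) -> S) (G : 'I_(size s) -> R) :
      (forall i, completion_coord (F i) k = quotring_pi (ideal_pow I k) (G i)) ->
      completion_coord (\sum_(i <- t) F i) k = quotring_pi (ideal_pow I k) (\sum_(i <- t) G i).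
    move=> FG; elim: t => [|i t IHt]; first by rewrite !big_nil; exact/esym/quotring_pi_eq0/submod0.
    by rewrite !big_cons quotring_piD -IHt -FG.
  rewrite uc; apply/esym/coord_sum => i.
  rewrite -[completion_coord _ _]/(completion_coord (rho i) k * quotring_pi (ideal_pow I k) s`_i).
  by rewrite Hrho -quotring_piM.
elim/big_ind: _ => [|a b|i _]; [exact: submod0|exact: submodD|].
apply: (@submodZ _ S^o); apply: mem_span; apply: map_f; exact: mem_nth.
Qed.

Lemma ideal_ext_mem (J : ideal R) r : J r -> ideal_ext I J (completion_of I r).
Proof.
by move=> Jr; apply: (@subset_span S S^o); exists r.
Qed.

Hypothesis noethR : noetherian R.

(** The kernel is generated by images of I^n, so an inclusion can be tested on elements of R. *)
Lemma completion_ker_ext n (J : ideal S) :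
  (forall r, ideal_pow I n r -> J (completion_of I r)) -> completion_ker n `<=` J.
Proof.
move=> HJ; have [s sn] := noethR (ideal_pow I n).
move=> x /(completion_ker_span sn); move: x; apply/span_subP => _ /mapP[r rs ->].
by apply: HJ; rewrite -sn; exact: mem_span.
Qed.

Lemma completion_ideal_of_pow n r :
  ideal_pow I n r -> ideal_pow (completion_ideal I) n (completion_of I r).
Proof.
elim: n r => [|n IHn] // r.
have @J : ideal R.
{ exists (fun r : R => ideal_pow (completion_ideal I) n.+1 (completion_of I r)).
  - by rewrite rmorph0; exact: (@submod0 _ S^o).
  - by move=> a b Ja Jb; rewrite rmorphD; exact: (@submodD _ S^o).
  - by move=> a b Jb; rewrite [completion_of I _]rmorphM; exact: (@submodZ _ S^o). }
suff H : ideal_pow I n.+1 `<=` J by exact: H.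
apply/ideal_smul_subP => a b Ia /IHn Ib.
rewrite -[submod_set _ _]/(ideal_pow (completion_ideal I) n.+1 (completion_of I (a * b))).
rewrite rmorphM; apply: (@ideal_smul_mem _ S^o) => //.
by apply/(completion_ker_of 1); rewrite -[a]mulr1; exact: (@ideal_smul_mem _ R^o).
Qed.

Lemma completion_ker_pow n : completion_ker n `<=` ideal_pow (completion_ideal I) n.
Proof. by apply: completion_ker_ext => r; exact: completion_ideal_of_pow. Qed.

End CompletionOfRing.

(** * Noetherianity of the completion of a local ring *)

Section Cohen.
Variables (A : comPzRingType).

Lemma maximal_non_fg (V : lmodType A) (S : submodule V) : ~ finitely_generated S ->
  exists J : submodule V, ~ finitely_generated J /\
    forall (T : submodule V) x, J `<=` T -> T x -> ~ J x -> finitely_generated T.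
Proof.
move=> nS.
pose P (X : set V) := X = set0 \/ exists2 J : submodule V, X = J & ~ finitely_generated J.
have [F FP Ftot|A0 [[->|[J -> nJ]] A0max]] := @Zorn_bigcup V P; first last.
- exists J; split=> // T x JT Tx nJx; apply: contrapT => nT.
  apply: (A0max T); last by right; exists T.
  by split=> // TJ; apply: nJx; exact: TJ.
- exfalso; apply: (A0max S); last by right; exists S.
  by split=> // S0; apply: (S0 0); exact: submod0.
have [[X FX X0]|noX] := pselect (exists2 X, F X & X !=set0); last first.
  left; rewrite -subset0 => x [X FX Xx]; apply: noX; exists X => //; by exists x.
have subm Y : F Y -> Y !=set0 -> exists2 J : submodule V, Y = J & ~ finitely_generated J.
  by move=> /FP[->|//] [].
have @U : submodule V.
{ apply: (@Submodule A V (\bigcup_(Y in F) Y)).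
  - by exists X => //; have [J -> _] := subm X FX X0; exact: submod0.
  - move=> x y [Y FY Yx] [Z FZ Zy].
    have [J YJ _] := subm Y FY (ex_intro _ x Yx).
    have [K ZK _] := subm Z FZ (ex_intro _ y Zy).
    have [YZ|ZY] := Ftot Y Z FY FZ.
      by exists Z => //; move: (YZ x Yx) Zy; rewrite ZK; exact: submodD.
    by exists Y => //; move: Yx (ZY y Zy); rewrite YJ; exact: submodD.
  - move=> r x [Y FY Yx]; exists Y => //; have [J YJ _] := subm Y FY (ex_intro _ x Yx).
    by move: Yx; rewrite YJ; exact: submodZ. }
right; exists U => // /fg_subP[s [sU Us]].
have [Y FY sY] : exists2 Y, F Y & Y !=set0 /\ forall v, v \in s -> Y v.
  elim: s sU {Us} => [|v s IHs] sU; first by exists X.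
  have [|Y FY [Y0 sY]] := IHs; first by move=> w ws; apply: sU; rewrite in_cons ws orbT.
  have [Z FZ Zv] : U v by apply: sU; rewrite mem_head.
  have [YZ|ZY] := Ftot Y Z FY FZ.
    exists Z => //; split; first by exists v.
    by move=> w; rewrite in_cons => /predU1P[->//|/sY/YZ].
  exists Y => //; split=> // w; rewrite in_cons => /predU1P[->|/sY//].
  exact: ZY.
have [J YJ nJ] := subm Y FY sY.1; apply: nJ; apply/fg_subP; exists s; split.
  by move=> v /sY.2; rewrite YJ.
by move=> x Jx; apply: Us; exists Y => //; rewrite YJ.
Qed.

(** Cohen's argument. If neither x nor y is in J, then J + (x) and (J : x) are strictly larger than
    J, hence finitely generated. Then J is generated by the parts in J of generators of J + (x) and
    by x times generators of (J : x). *)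
Lemma maximal_non_fg_prime (J : ideal A) (x y : A) :
  ~ finitely_generated J ->
  (forall (T : ideal A) z, J `<=` T -> T z -> ~ J z -> finitely_generated T) ->
  J (x * y) -> J x \/ J y.
Proof.
move=> nJ Jmax Jxy; apply: contrapT => /not_orP[nx ny]; apply: nJ.
pose F : ideal A := full_submodule A^o.
have /fg_subP[s [sJ Js]] : finitely_generated (@submod_adjoin A A^o J F x).
  apply: (Jmax _ x) => //; first exact: submod_adjoin_sub.
  by have := @submod_adjoin_mem A A^o J F x 1 Logic.I; rewrite scale1r.
have /fg_subP[t [tJ Jt]] : finitely_generated (@ideal_colon A A^o J x).
  apply: (Jmax _ y) => //.
    by move=> z Jz; rewrite -[submod_set _ _]/(J (z * x)) mulrC; exact: (@submodZ _ A^o).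
  by move: Jxy; rewrite mulrC.
have [|r Hr] := @choice A A (fun g r => g \in s -> J (g - r * x)).
  move=> g; case: (boolP (g \in s)) => [/sJ[r _ Hr]|_]; last by exists 0.
  by exists r.
pose js : seq A^o := [seq g - r g * x | g <- s].
pose ts : seq A^o := [seq u * x | u <- t].
apply/fg_subP; exists (js ++ ts); split.
  move=> v; rewrite mem_cat => /orP[/mapP[g gs ->]|/mapP[u /tJ ut ->]] //; exact: Hr.
move=> z Jz.
have [e _ Hze] : @submod_adjoin A A^o (span [set` js]) F x z.
  suff H : span [set` s] `<=` @submod_adjoin A A^o (span [set` js]) F x.
    by apply/H/Js; exact: submod_adjoin_sub.
  apply/span_subP => g gs; exists (r g) => //.
  by apply: mem_span; apply/mapP; exists g.
have Jjs : span [set` js] `<=` J.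
  by apply/span_subP => _ /mapP[g gs ->]; exact: Hr.
have Je : @ideal_colon A A^o J x e.
  rewrite -[submod_set _ _]/(J (e * x)).
  suff -> : e * x = z - (z - e * x) by apply: submodB => //; exact: Jjs.
  by rewrite opprB addrC subrK.
rewrite -[z](subrK (e * x)); apply: submodD.
  move: Hze; move: (z - _); apply/span_subP => v vs.
  by apply: mem_span; rewrite mem_cat; apply/orP; left.
have {Je} : span [set` t] e by exact: Jt.
have H : span [set` t] `<=` @ideal_colon A A^o (span [set` js ++ ts]) x.
  apply/span_subP => u ut; apply: mem_span; rewrite mem_cat; apply/orP; right.
  exact: (map_f (fun u => u * x)).
exact: H.
Qed.

End Cohen.

Section LocalCompletion.
Variables (R : comPzRingType) (m : ideal R).
Hypotheses (noethR : noetherian R) (R_local : local_ring m).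
Local Notation S := (completion_ring m).
Local Notation mS := (completion_ideal m).

Lemma completion_ker_mulS n (x y : S) :
  mS x -> completion_ker m n y -> completion_ker m n.+1 (x * y).
Proof.
move=> mx Hy.
suff H : completion_ker m 1 `<=` @ideal_colon S S^o (completion_ker m n.+1) y by exact: H.
apply: completion_ker_ext => // r mr.
have [u yu] := completion_ring_approx y n.+1.
have Iu : ideal_pow m n u.
  apply/completion_ker_of; suff -> : completion_of m u = y - (y - completion_of m u).
    by apply: (@submodB _ S^o) => //; exact: completion_kerS.
  by rewrite opprB addrC subrK.
rewrite -[submod_set _ _]/(completion_ker m n.+1 (completion_of m r * y)).
rewrite -[y](subrK (completion_of m u)) mulrDr; apply: (@submodD _ S^o).
  exact: (@submodZ _ S^o).
by rewrite -rmorphM; apply/completion_ker_of; exact: (@ideal_powM _ m 1 n).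
Qed.

Lemma completion_ker_exp n (x : S) : mS x -> completion_ker m n (x ^+ n).
Proof.
by move=> mx; elim: n => [|n IHn]; [exact/completion_ker_of|rewrite exprS; exact: completion_ker_mulS].
Qed.

(** The inverse is the limit of the geometric series. *)
Lemma completion_unit1B (t : S) : mS t -> exists u, u * (1 - t) = 1.
Proof.
move=> mt.
have [|u Hu] := @completion_ring_complete R m (fun n => \sum_(k < n) t ^+ k).
  by move=> n; rewrite big_ord_recr /= addrAC subrr add0r; exact: completion_ker_exp.
exists u; apply/eqP; rewrite -subr_eq0; apply/eqP; apply: completion_ring_separated => n.
suff -> : u * (1 - t) - 1 = (1 - t) * (u - \sum_(k < n) t ^+ k) - t ^+ n.
  apply: (@submodB _ S^o); last exact: completion_ker_exp.
  exact: (@submodZ _ S^o).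
have H : (1 - t) * (\sum_(k < n) t ^+ k) = 1 - t ^+ n.
  by rewrite -opprB mulNr -subrX1 opprB.
by rewrite [in RHS]mulrBr H opprB addrA addrAC addrK mulrC.
Qed.

Lemma completion_unit (x : S) : ~ mS x -> exists u, u * x = 1.
Proof.
move=> mx; have [r xr] := completion_ring_approx x 1.
have mr : ~ m r.
  move=> mr; apply: mx; rewrite -[x](subrK (completion_of m r)).
  apply: (@submodD _ S^o) => //; apply/(completion_ker_of m 1).
  by rewrite -[r]mulr1; exact: (@ideal_smul_mem _ R^o).
have [v vr] := local_ring_unit noethR R_local mr.
pose t := 1 - completion_of m v * x.
have [|u ut] := @completion_unit1B t.
  have -> : t = - (completion_of m v * (x - completion_of m r)).
    by rewrite mulrBr -rmorphM vr rmorph1 opprB.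
  by apply: (@submodN _ S^o); exact: (@submodZ _ S^o).
exists (u * completion_of m v).
by move: ut; rewrite /t opprB addrCA subrr addr0 mulrA.
Qed.

(** A maximal counterexample J is prime. If it contains mS, it is mS or S, both finitely generated.
    Otherwise some generator t of mS is not in J, and primality gives J = (js) + t J with finitely
    many [js], since t e in J forces e in J. Iterating this equation converges, because powers of t
    tend to 0. *)
Lemma completion_noetherian : noetherian S.
Proof.
move=> J0; apply: contrapT => /maximal_non_fg[J [nJ Jmax]].
have Jprime x y := @maximal_non_fg_prime S J x y nJ Jmax.
have [s0 s0m] := noethR (ideal_pow m 1).
pose s := map (completion_of m : R^o -> S^o) s0.
have sm : mS `<=` span [set` s] by move=> x mx; exact: (@completion_ker_span R m 1 s0 s0m x mx).
have ms t : t \in s -> mS t.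
  move=> /mapP[r rs ->]; apply/(completion_ker_of m 1); rewrite -s0m; exact: mem_span.
have [t ts Jt] : exists2 t, t \in s & ~ J t.
  apply: contrapT => H; apply: nJ.
  have mJ : mS `<=` J.
    move=> x /sm; move: x; apply/span_subP => t ts; apply: contrapT => nt.
    by apply: H; exists t.
  have [[x Jx mx]|H'] := pselect (exists2 x, J x & ~ mS x).
    have [u ux] := completion_unit mx; apply/fg_subP; exists [:: (1 : S^o)]; split.
      by move=> v; rewrite inE => /eqP ->; rewrite -ux; exact: (@submodZ _ S^o).
    by move=> v _; rewrite -[v]mulr1; apply: (@submodZ _ S^o); apply: mem_span; rewrite mem_head.
  apply/fg_subP; exists s; split=> [v /ms/mJ //|x Jx]; apply: sm.
  by apply: contrapT => mx; apply: H'; exists x.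
pose F : ideal S := full_submodule S^o.
have /fg_subP[g [gJ Jg]] : finitely_generated (@submod_adjoin S S^o J F t).
  apply: (Jmax _ t) => //; first exact: submod_adjoin_sub.
  by have := @submod_adjoin_mem S S^o J F t 1 Logic.I; rewrite scale1r.
have [|r Hr] := @choice S S (fun v r => v \in g -> J (v - r * t)).
  move=> v; case: (boolP (v \in g)) => [/gJ[r _ Hr]|_]; last by exists 0.
  by exists r.
pose js : seq S^o := [seq v - r v * t | v <- g].
have Jjs : span [set` js] `<=` J.
  by apply/span_subP => _ /mapP[v vg ->]; exact: Hr.
have step z : J z -> exists c : ('I_(size js) -> S) * S,
    J c.2 /\ z = \sum_i c.1 i * js`_i + t * c.2.
  move=> Jz; have [e _ Hze] : @submod_adjoin S S^o (span [set` js]) F t z.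
    suff H : span [set` g] `<=` @submod_adjoin S S^o (span [set` js]) F t.
      by apply/H/Jg; exact: submod_adjoin_sub.
    by apply/span_subP => v vg; exists (r v) => //; apply: mem_span; apply/mapP; exists v.
  have [c zc] := span_sum Hze.
  exists (c, e); split=> /=; last first.
    have -> : \sum_i c i * js`_i = z - e * t by exact: esym zc.
    by rewrite [t * e]mulrC subrK.
  suff : J (t * e) by case/Jprime.
  have -> : t * e = z - (z - e * t) by rewrite opprB addrC subrK mulrC.
  by apply: submodB => //; exact: Jjs.
have [|C HC] := @choice S (('I_(size js) -> S) * S) (fun z c => J z ->
    J c.2 /\ z = \sum_i c.1 i * js`_i + t * c.2).
  move=> z; have [/step[c Hc]|nz] := pselect (J z); first by exists c.
  by exists (fun=> 0, 0).
apply: nJ; apply/fg_subP; exists js; split=> [v vj|z Jz]; first exact/Jjs/mem_span.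
pose zs k := iter k (fun z => (C z).2) z.
have Jzs k : J (zs k) by elim: k => //= k /HC[].
(* Coefficients after n rounds of z = combination of js + t z', with remainder t^n times [zs n]. *)
pose rho n i := \sum_(k < n) t ^+ k * (C (zs k)).1 i.
have zrho n : z = \sum_i rho n i * js`_i + t ^+ n * zs n.
  elim: n => [|n {1}->].
    by rewrite big1 ?add0r ?mul1r // => i _; rewrite /rho big_ord0 mul0r.
  rewrite [X in t ^+ n * X](HC _ (Jzs n)).2 mulrDr addrA mulrA -exprSr; congr (_ + _).
  rewrite mulr_sumr -big_split; apply: eq_bigr => i _.
  by rewrite /rho big_ord_recr /= mulrDl mulrA.
have [|rl Hrl] := @choice 'I_(size js) S (fun i y => forall n, completion_ker m n (y - rho n i)).
  move=> i; apply: completion_ring_complete => n.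
  rewrite /rho big_ord_recr /= addrAC subrr add0r mulrC; apply: (@submodZ _ S^o).
  by apply: completion_ker_exp; exact: ms.
suff -> : z = \sum_i rl i * js`_i.
  elim/big_ind: _ => [|a b|i _]; [exact: submod0|exact: submodD|].
  by apply: (@submodZ _ S^o); apply: mem_span; exact: mem_nth.
apply/eqP; rewrite -subr_eq0; apply/eqP; apply: completion_ring_separated => n.
rewrite {1}(zrho n) addrAC -sumrB; apply: (@submodD _ S^o); last first.
  by rewrite mulrC; apply: (@submodZ _ S^o); apply: completion_ker_exp; exact: ms.
elim/big_ind: _ => [|a b|i _]; [exact: (@submod0 _ S^o)|exact: (@submodD _ S^o)|].
rewrite -mulrBl -opprB mulNr; apply: (@submodN _ S^o); rewrite mulrC.
by apply: (@submodZ _ S^o); exact: Hrl.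
Qed.

End LocalCompletion.

(** * The completion of a finitely generated module *)

Section CompletionOfModule.
Variables (R : comPzRingType) (m : ideal R) (M : lmodType R).
Hypotheses (noethR : noetherian R) (R_local : local_ring m)
  (M_fg : finitely_generated (full_submodule M)).
Local Notation S := (completion_ring m).
Local Notation mS := (completion_ideal m).
Local Notation Mc := (completion m M).
Local Notation mM n := (ideal_smul (ideal_pow m n) (full_submodule M)).
Implicit Types (x y : M) (X Y : Mc) (r : R) (s : S).

Definition completion_mod (x : M) : Mc :=
  @InvLim _ _ (@adic_proj R m M) (fun n => \pi_(quotmod (mM n)) x)
    (fun n => @adic_projE R m M n x).

Lemma completion_modB : {morph completion_mod : x y / x - y}.
Proof. by move=> x y; apply: invlim_ext => n; exact: quotmod_piB. Qed.

HB.instance Definition _ :=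
  GRing.isZmodMorphism.Build M Mc completion_mod completion_modB.

Lemma completion_modZ r x :
  completion_mod (r *: x) = completion_of m r *: completion_mod x.
Proof. by apply: invlim_ext => n; apply/esym; exact: quot_actE. Qed.

Lemma quotmod_pi_eq0 (V : lmodType R) (T : submodule V) (x0 : V) : \pi_(quotmod T) x0 = 0 <-> T x0.
Proof.
have <- : \pi_(quotmod T) 0 = 0 by rewrite -[RHS](subrr (\pi_(quotmod T) 0)) -quotmod_piB subrr.
by rewrite -quotmodP subr0.
Qed.

Definition completion_mod_ker (n : nat) : submodule Mc.
Proof.
apply: (@Submodule S Mc (fun X : Mc => invlim_fun X n = 0)).
- by [].
- by move=> X Y; rewrite -[invlim_fun (X + Y) n]/(invlim_fun X n + invlim_fun Y n) => -> ->;
    rewrite addr0.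
- move=> s X X0; rewrite -[LHS]/(quot_act (completion_coord s n) (invlim_fun X n)) X0.
  have [r ->] := quotring_repr (completion_coord s n).
  rewrite -(iffRL (@quotmod_pi_eq0 _ (mM n) 0) (submod0 _)).
  by rewrite quot_actE scaler0.
Defined.

Lemma completion_mod_kerB n X Y :
  completion_mod_ker n (X - Y) <-> invlim_fun X n = invlim_fun Y n.
Proof.
rewrite -[submod_set _ _]/(invlim_fun X n - invlim_fun Y n = 0).
by split=> [/eqP|->]; rewrite ?subr_eq0 ?subrr // => /eqP.
Qed.

Lemma completion_mod_ker_of n x : completion_mod_ker n (completion_mod x) <-> mM n x.
Proof. exact: quotmod_pi_eq0. Qed.

Lemma completion_mod_complete (X : nat -> Mc) :
  (forall n, completion_mod_ker n (X n.+1 - X n)) ->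
  exists Y, forall n, completion_mod_ker n (Y - X n).
Proof.
move=> HX; have [|Y HY] := @invlim_complete R M (fun n => mM n) (@adic_proj R m M) X.
  by move=> n; apply/completion_mod_kerB.
by exists Y => n; apply/completion_mod_kerB; exact: HY.
Qed.

Lemma completion_mod_approx X n : exists x, completion_mod_ker n (X - completion_mod x).
Proof.
exists (repr (invlim_fun X n)); apply/completion_mod_kerB.
by rewrite -[LHS]reprK.
Qed.

Lemma completion_mod_kerS n X : completion_mod_ker n.+1 X -> completion_mod_ker n X.
Proof.
by move=> Xn; rewrite -[submod_set _ _]/(invlim_fun X n = 0) -invlimP [invlim_fun _ _]Xn linear0.
Qed.

Lemma completion_mod_ker_le n k X :
  (n <= k)%N -> completion_mod_ker k X -> completion_mod_ker n X.
Proof. by move=> /subnK <-; elim: (k - n)%N => // d IHd /completion_mod_kerS. Qed.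

Lemma completion_ker_scale n s X : completion_ker m n s -> completion_mod_ker n (s *: X).
Proof.
move=> s0; rewrite -[submod_set _ _]/(quot_act (completion_coord s n) (invlim_fun X n) = 0).
rewrite [completion_coord s n]s0.
have -> : invlim_fun X n = \pi_(quotmod (mM n)) (repr (invlim_fun X n)) by rewrite reprK.
rewrite -(iffRL (quotring_pi_eq0 m n 0) (submod0 _)) quot_actE scale0r.
by apply/quotmod_pi_eq0; exact: submod0.
Qed.

(** Here the generators span all of M, so the increments of the coefficients lie in m^(max k n):
    bound k makes them converge, bound n keeps the limits in [completion_ker n]. *)
Lemma completion_mod_ker_sum n (g : seq M) :
  span [set` g] = full_submodule M :> set M ->
  forall X, completion_mod_ker n X ->
  exists rho : 'I_(size g) -> S, (forall i, completion_ker m n (rho i)) /\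
    X = \sum_i rho i *: completion_mod g`_i.
Proof.
move=> gM X X0; have [u [u0 Xu Fu]] := @invlim_cauchy0 R M (fun n => mM n) (@adic_proj R m M)
  (@adic_projE R m M) X n X0.
have [||c [c0 Fc uc]] := @telescope _ M (fun k => ideal_pow m (maxn k n)) g u.
- exact: u0.
- by move=> k; apply: ideal_smul_mono (Fu k) => //; rewrite gM.
have [|rho Hrho] := @choice 'I_(size g) S
  (fun i s => forall k, completion_coord s k = quotring_pi (ideal_pow m k) (c k i)).
  move=> i; apply: completion_ring_cauchy => k; apply: ideal_pow_le (Fc k i).
  exact: leq_maxl.
exists rho; split=> [i|].
  rewrite -[submod_set _ _]/(completion_coord (rho i) n = 0) Hrho.
  apply/quotring_pi_eq0.
  have H k : ideal_pow m n (c k i).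
    elim: k => [|k IHk]; first by rewrite c0; exact: submod0.
    rewrite -[c k.+1 i](subrK (c k i)); apply: submodD => //.
    by apply: ideal_pow_le (Fc k i); exact: leq_maxr.
  exact: H.
apply: invlim_ext => k; rewrite (Xu k k (leqnn k)) uc.
have coord_sum (t : seq 'I_(size g)) (F : 'I_(size g) -> Mc) (G : 'I_(size g) -> M) :
    (forall i, invlim_fun (F i) k = \pi_(quotmod (mM k)) (G i)) ->
    invlim_fun (\sum_(i <- t) F i) k = \pi_(quotmod (mM k)) (\sum_(i <- t) G i).
  move=> FG; elim: t => [|i t IHt].
    by rewrite !big_nil; exact/esym/quotmod_pi_eq0/submod0.
  rewrite !big_cons quotmod_piD -IHt -FG //.
apply/esym/coord_sum => i.
rewrite -[LHS]/(quot_act (completion_coord (rho i) k) (\pi_(quotmod (mM k)) g`_i)).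
by rewrite Hrho quot_actE.
Qed.

Lemma completion_mod_noetherian : noetherian_module Mc.
Proof.
apply: noetherian_fg; first exact: completion_noetherian.
have [g gM] := M_fg; apply/fg_subP; exists (map completion_mod g); split=> // X _.
(* Level 0 is no restriction, as m^0 M = M. *)
have [|rho [_ ->]] := @completion_mod_ker_sum 0 g gM X.
  rewrite -[submod_set _ _]/(invlim_fun X 0 = 0) -[invlim_fun X 0]reprK.
  by apply/quotmod_pi_eq0; rewrite -[repr _]scale1r; exact: ideal_smul_mem.
elim/big_ind: _ => [|a b|i _]; [exact: submod0|exact: submodD|].
by apply: submodZ; apply: mem_span; apply: map_f; exact: mem_nth.
Qed.

Lemma completion_mod_ker_pow n :
  completion_mod_ker n `<=` ideal_smul (ideal_pow mS n) (full_submodule Mc).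
Proof.
move=> X X0; have [g gM] := M_fg.
have [rho [rho0 ->]] := completion_mod_ker_sum gM X0.
elim/big_ind: _ => [|a b|i _]; [exact: submod0|exact: submodD|].
by apply: ideal_smul_mem => //; exact: completion_ker_pow.
Qed.

Lemma completion_mod_closed (T : submodule Mc) X :
  (forall n, exists2 Y, T Y & completion_mod_ker n (X - Y)) -> T X.
Proof.
move=> HX; apply: (@submodule_closed S Mc (completion_noetherian noethR R_local)
  completion_mod_noetherian mS T X).
- by move=> t; exact: completion_unit1B.
- by move=> n; have [Y TY XY] := HX n; exists Y => //; exact: completion_mod_ker_pow.
Qed.

Lemma completion_mod_ker_mulS n s X :
  mS s -> completion_mod_ker n X -> completion_mod_ker n.+1 (s *: X).
Proof.
move=> ms HX.
suff H : completion_ker m 1 `<=` ideal_colon (completion_mod_ker n.+1) X by exact: H.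
apply: completion_ker_ext => // r mr.
have [x Xx] := completion_mod_approx X n.+1.
have Mx : mM n x.
  apply/completion_mod_ker_of.
  suff -> : completion_mod x = X - (X - completion_mod x).
    by apply: submodB => //; exact: completion_mod_kerS.
  by rewrite opprB addrC subrK.
rewrite -[submod_set _ _]/(completion_mod_ker n.+1 (completion_of m r *: X)).
rewrite -[X](subrK (completion_mod x)) scalerDr; apply: submodD; first exact: submodZ.
rewrite -completion_modZ; apply/completion_mod_ker_of.
suff H : mM n `<=` submod_colon (mM n.+1) r by exact: H.
apply/ideal_smul_subP => t y It _.
rewrite -[submod_set _ _]/(mM n.+1 (r *: (t *: y))) scalerA.
by apply: ideal_smul_mem => //; exact: (@ideal_powM _ m 1 n).
Qed.

Variable a : ideal R.

(** The elements of S congruent modulo [completion_ker m l] to the image of an element of J form an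
    ideal, so it suffices to approximate products factor by factor. *)
Lemma ideal_ext_pow_approx n l s : ideal_pow (ideal_ext m a) n s ->
  exists2 r, ideal_pow a n r & completion_ker m l (s - completion_of m r).
Proof.
have near_ideal (J : ideal R) : exists J' : ideal S, forall s,
    J' s <-> exists2 r, J r & completion_ker m l (s - completion_of m r).
  have @J' : ideal S.
  { apply: (@Submodule S S^o (fun s => exists2 r, J r & completion_ker m l (s - completion_of m r))).
  - by exists 0; [exact: (@submod0 _ R^o)|rewrite rmorph0 subr0; exact: (@submod0 _ S^o)].
  - move=> s1 s2 [r1 J1 H1] [r2 J2 H2]; exists (r1 + r2); first exact: (@submodD _ R^o).
    by rewrite rmorphD opprD addrACA; exact: (@submodD _ S^o).
  - move=> t s1 [r1 J1 H1]; have [r tr] := completion_ring_approx t l.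
    exists (r * r1); first exact: (@submodZ _ R^o).
    have -> : t *: s1 - completion_of m (r * r1) =
      t * (s1 - completion_of m r1) + completion_of m r1 * (t - completion_of m r).
      rewrite rmorphM !mulrBr addrA [completion_of m r1 * t]mulrC subrK.
      by rewrite [_ r1 * _]mulrC.
    by apply: (@submodD _ S^o); exact: (@submodZ _ S^o). }
  by exists J'.
elim: n s => [|n IHn] s.
  by move=> _; have [r sr] := completion_ring_approx s l; exists r.
have [J' J'P] := near_ideal (ideal_pow a n.+1).
suff H : ideal_pow (ideal_ext m a) n.+1 `<=` J' by move=> /H/J'P.
apply/ideal_smul_subP => t s1 at_ /IHn[r1 ar1 Hr1].
have [A' A'P] := near_ideal a.
have /A'P[r ar tr] : A' t.
  suff H : ideal_ext m a `<=` A' by exact: H.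
  apply/span_subP => _ [r [ar ->]]; apply/A'P; exists r => //.
  by rewrite subrr; exact: (@submod0 _ S^o).
apply/J'P; exists (r * r1); first exact: (@ideal_smul_mem _ R^o).
have -> : t *: s1 - completion_of m (r * r1) =
  t * (s1 - completion_of m r1) + completion_of m r1 * (t - completion_of m r).
  rewrite rmorphM !mulrBr addrA [completion_of m r1 * t]mulrC subrK.
  by rewrite [_ r1 * _]mulrC.
by apply: (@submodD _ S^o); exact: (@submodZ _ S^o).
Qed.

(** Density of a^n M in a^n M^. It is what makes M^/a^n M^ induce on M/a^n M exactly the m-adic
    filtration. *)
Lemma ideal_ext_smul_approx n l X :
  ideal_smul (ideal_pow (ideal_ext m a) n) (full_submodule Mc) X ->
  exists2 x, ideal_smul (ideal_pow a n) (full_submodule M) x &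
    completion_mod_ker l (X - completion_mod x).
Proof.
set T := ideal_smul (ideal_pow a n) _.
have @U : submodule Mc.
{ apply: (@Submodule S Mc (fun X => exists2 x, T x & completion_mod_ker l (X - completion_mod x))).
  - by exists 0; [exact: submod0|rewrite raddf0 subr0; exact: submod0].
  - move=> X1 X2 [x1 T1 H1] [x2 T2 H2]; exists (x1 + x2); first exact: submodD.
    by rewrite raddfD opprD addrACA; exact: submodD.
  - move=> s X1 [x1 T1 H1]; have [r sr] := completion_ring_approx s l.
    exists (r *: x1); first exact: submodZ.
    have -> : s *: X1 - completion_mod (r *: x1) =
      s *: (X1 - completion_mod x1) + (s - completion_of m r) *: completion_mod x1.
      by rewrite completion_modZ scalerBr scalerBl addrA subrK.
    by apply: submodD; [exact: submodZ|exact: completion_ker_scale]. }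
suff H : ideal_smul (ideal_pow (ideal_ext m a) n) (full_submodule Mc) `<=` U by exact: H.
apply/ideal_smul_subP => s X1 /(@ideal_ext_pow_approx _ l)[r ar sr] _.
have [x Xx] := completion_mod_approx X1 l; exists (r *: x); first exact: ideal_smul_mem.
have -> : s *: X1 - completion_mod (r *: x) =
  s *: (X1 - completion_mod x) + (s - completion_of m r) *: completion_mod x.
  by rewrite completion_modZ scalerBr scalerBl addrA subrK.
by apply: submodD; [exact: submodZ|exact: completion_ker_scale].
Qed.

Lemma ideal_ext_of n r : ideal_pow a n r -> ideal_pow (ideal_ext m a) n (completion_of m r).
Proof.
elim: n r => [|n IHn] // r.
have @J : ideal R.
{ exists (fun r : R => ideal_pow (ideal_ext m a) n.+1 (completion_of m r)).
  - by rewrite rmorph0; exact: (@submod0 _ S^o).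
  - by move=> b c Jb Jc; rewrite rmorphD; exact: (@submodD _ S^o).
  - by move=> b c Jc; rewrite [completion_of m _]rmorphM; exact: (@submodZ _ S^o). }
suff H : ideal_pow a n.+1 `<=` J by exact: H.
apply/ideal_smul_subP => b c ab /IHn Ic.
rewrite -[submod_set _ _]/(ideal_pow (ideal_ext m a) n.+1 (completion_of m (b * c))).
rewrite rmorphM; apply: (@ideal_smul_mem _ S^o) => //.
exact: ideal_ext_mem.
Qed.

Lemma ideal_ext_smul_of n x : ideal_smul (ideal_pow a n) (full_submodule M) x ->
  ideal_smul (ideal_pow (ideal_ext m a) n) (full_submodule Mc) (completion_mod x).
Proof.
set T := ideal_smul (ideal_pow (ideal_ext m a) n) _.
have @U : submodule M.
{ exists (fun x => T (completion_mod x)).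
  - by rewrite raddf0; exact: submod0.
  - by move=> b c Jb Jc; rewrite raddfD; exact: submodD.
  - by move=> b c Jc; rewrite completion_modZ; exact: submodZ. }
suff H : ideal_smul (ideal_pow a n) (full_submodule M) `<=` U by exact: H.
apply/ideal_smul_subP => r y ar _.
rewrite -[submod_set _ _]/(T (completion_mod (r *: y))) completion_modZ.
by apply: ideal_smul_mem => //; exact: ideal_ext_of.
Qed.

End CompletionOfModule.

(** * Linear compactness *)

Section DescendingChains.
Variables (A : comPzRingType) (mA : ideal A) (V : lmodType A) (W : submodule V).
Hypothesis A_local : forall c : A, ~ mA c -> exists d, d * c = 1.

Lemma nonincreasing_submodules (T_ : nat -> submodule V) n k :
  (forall n, T_ n.+1 `<=` T_ n) -> (n <= k)%N -> T_ k `<=` T_ n.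
Proof.
by move=> T_decr /subnK <-; elim: (k - n)%N => // d IHd x /T_decr /IHd.
Qed.

(* Modulo W the span of s is a finite dimensional space over the residue field. *)
Lemma dcc_mod_span (s : seq V) (U_ : nat -> submodule V) :
  (forall c v, mA c -> v \in s -> W (c *: v)) ->
  (forall n, U_ n.+1 `<=` U_ n) ->
  (forall n, U_ n `<=` submod_add (span [set` s]) W) ->
  exists nu, forall n, (nu <= n)%N -> U_ nu `<=` submod_add (U_ n) W.
Proof.
elim: s U_ => [|v s IHs] U_ mW U_decr Us.
  exists 0%N => n _ x /Us[y /span_nil -> Wx].
  by exists 0 => //; exact: submod0.
have [|||nu1 Hnu1] := IHs (fun n => submod_cap (U_ n) (submod_add (span [set` s]) W)).
- by move=> c u mc us; apply: mW; rewrite // in_cons us orbT.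
- by move=> n x [/U_decr Ux Bx].
- by move=> n x [].
set B := submod_add (span [set` s]) W in Hnu1.
have Bv n x : U_ n x -> exists c, B (x - c *: v).
  move=> /Us[y /span_consP[c Hc] Wxy]; exists c; exists (y - c *: v) => //.
  by rewrite opprB addrA subrK.
have [Pn|/existsNP[n0 nP]] := pselect (forall n, exists2 u, U_ n u & B (u - v)).
- exists nu1 => n nu1n x Ux; have [c Hc] := Bv _ _ Ux; have [u Uu Hu] := Pn n.
  have [|y [Uy _] Wy] := Hnu1 n nu1n (x - c *: u).
    split; first by apply: submodB => //; apply: submodZ; exact: nonincreasing_submodules Uu.
    suff -> : x - c *: u = (x - c *: v) - c *: (u - v).
      by apply: submodB => //; exact: submodZ.
    by rewrite scalerBr opprB addrA subrK.
  exists (c *: u + y); last by rewrite opprD addrA.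
  by apply: submodD => //; exact: submodZ.
- exists (maxn nu1 n0) => n; rewrite geq_max => /andP[nu1n n0n] x Ux.
  have [c Hc] := Bv _ _ Ux.
  have mc : mA c.
    apply: contrapT => /A_local[d dc]; apply: nP; exists (d *: x).
      by apply: submodZ; apply: nonincreasing_submodules Ux => //; exact: leq_maxr.
    suff -> : d *: x - v = d *: (x - c *: v) by exact: submodZ.
    by rewrite scalerBr scalerA dc scale1r.
  have [|y [Uy _] Wy] := Hnu1 n nu1n x; last by exists y.
  split; first by apply: nonincreasing_submodules Ux => //; exact: leq_maxl.
  rewrite -[x](subrK (c *: v)); apply: submodD => //; apply: submod_addr.
  by apply: mW; rewrite // mem_head.
Qed.

End DescendingChains.

Section LinearCompactness.
Variables (R : comPzRingType) (m : ideal R) (M : lmodType R).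
Hypotheses (noethR : noetherian R) (R_local : local_ring m)
  (M_fg : finitely_generated (full_submodule M)).
Local Notation Mc := (completion m M).
Local Notation K := (@completion_mod_ker R m M).
Variable T_ : nat -> submodule Mc.
Hypothesis T_decr : forall n, T_ n.+1 `<=` T_ n.

(** M^ modulo [K l] has finite length. In the step from l to l + 1 the chain is already stable
    modulo [K l], and its part inside [K l] is handled by [dcc_mod_span], since mS maps [K l] into
    [K l.+1]. *)
Lemma completion_mod_dcc l :
  exists nu, forall n, (nu <= n)%N -> T_ nu `<=` submod_add (T_ n) (K l).
Proof.
elim: l => [|l [nu1 Hnu1]].
  exists 0%N => n _ x _; apply: submod_addr.
  rewrite -[submod_set _ _]/(invlim_fun x 0 = 0) -[invlim_fun x 0]reprK.
  by apply/quotmod_pi_eq0; rewrite -[repr _]scale1r; exact: ideal_smul_mem.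
have /fg_subP[s [sK Ks]] := completion_mod_noetherian noethR R_local M_fg (K l).
have [|||nu2 Hnu2] := @dcc_mod_span _ (completion_ideal m) Mc (K l.+1)
  (@completion_unit R m noethR R_local) s (fun n => submod_cap (T_ n) (K l)).
- by move=> c v mc /sK; exact: completion_mod_ker_mulS.
- by move=> n x [/T_decr].
- by move=> n x [_ /Ks]; exact: submod_addl.
exists (maxn nu1 nu2) => n; rewrite geq_max => /andP[nu1n nu2n] x Tx.
have Tx1 : T_ nu1 x by apply: nonincreasing_submodules Tx => //; exact: leq_maxl.
(* The index is at least nu2, so that x - y stays in [T_ nu2], and at least n, so that y is in
   [T_ n]. *)
have [y Ty Kxy] : submod_add (T_ (maxn n nu2)) (K l) x.
  apply: Hnu1 => //; apply: leq_trans nu1n _; exact: leq_maxl.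
have [|z [Tz _] Kz] := Hnu2 n nu2n (x - y).
  split=> //; apply: submodB; last by apply: nonincreasing_submodules Ty => //; exact: leq_maxr.
  by apply: nonincreasing_submodules Tx => //; exact: leq_maxr.
exists (y + z); last by rewrite opprD addrA.
apply: submodD => //; apply: nonincreasing_submodules Ty => //; exact: leq_maxl.
Qed.

(** The cosets of [T_ n] at [y_ n] decrease. Points z l of a subsequence of cosets are chosen with z
    (l + 1) - z l in [K l]; their limit lies in every coset because submodules are closed. *)
Lemma completion_mod_linearly_compact (y_ : nat -> Mc) :
  (forall n, T_ n (y_ n.+1 - y_ n)) -> exists y, forall n, T_ n (y - y_ n).
Proof.
move=> Ty.
have Tyle n k : (n <= k)%N -> T_ n (y_ k - y_ n).
  move=> /subnK <-; elim: (k - n)%N => [|d IHd]; first by rewrite subrr; exact: submod0.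
  rewrite -[_ - _](subrKA (y_ (d + n)%N)); apply: submodD => //.
  by apply: nonincreasing_submodules (Ty _) => //; exact: leq_addl.
have /choice[nu nuP] := completion_mod_dcc.
(* Monotone, at least [nu l] so that the chain is stable modulo [K l], and at least l so that every
   coset is reached. *)
pose N l := (\sum_(j < l.+1) nu j + l)%N.
have N_ge l : (nu l <= N l)%N by rewrite /N big_ord_recr /= -addnA addnCA leq_addr.
have N_incr l : (N l <= N l.+1)%N.
  by rewrite /N [(\sum_(j < l.+2) _)%N]big_ord_recr /= leq_add // leq_addr.
have step l z : exists z', T_ (N l) (z - y_ (N l)) ->
    T_ (N l.+1) (z' - y_ (N l.+1)) /\ K l (z' - z).
  have [Tz|nTz] := pselect (T_ (N l) (z - y_ (N l))); last by exists 0.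
  have : T_ (N l) (y_ (N l.+1) - z).
    by rewrite -[_ - _](subrKA (y_ (N l))) -[_ - z]opprB; apply: submodB => //; exact: Tyle.
  move=> /(nonincreasing_submodules T_decr (N_ge l)).
  move=> /(nuP l (N l.+1) (leq_trans (N_ge l) (N_incr l)))[t Tt Kt].
  exists (y_ (N l.+1) - t) => _; split; last by rewrite addrAC.
  by rewrite addrAC subrr add0r; exact: submodN.
have [G GP] : {G : nat -> Mc -> Mc | forall l z, T_ (N l) (z - y_ (N l)) ->
    T_ (N l.+1) (G l z - y_ (N l.+1)) /\ K l (G l z - z)}.
  have [G GP] := @choice (nat * Mc) Mc (fun lz z' => T_ (N lz.1) (lz.2 - y_ (N lz.1)) ->
    T_ (N lz.1.+1) (z' - y_ (N lz.1.+1)) /\ K lz.1 (z' - lz.2)) (fun lz => step lz.1 lz.2).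
  by exists (fun l z => G (l, z)) => l z; exact: (GP (l, z)).
pose z := fix z l := if l is l'.+1 then G l' (z l') else y_ (N 0%N).
have zT l : T_ (N l) (z l - y_ (N l)).
  by elim: l => [|l /GP[]//]; rewrite subrr; exact: submod0.
have [|y yz] := @completion_mod_complete R m M z; first by move=> l; case: (GP _ _ (zT l)).
exists y => n; apply: (completion_mod_closed noethR R_local M_fg) => l.
have le1 : (n <= N (maxn l n))%N.
  by apply: leq_trans (leq_addl _ _); exact: leq_maxr.
exists (z (maxn l n) - y_ n).
  rewrite -[_ - _](subrKA (y_ (N (maxn l n)))); apply: submodD; last exact: Tyle.
  exact: nonincreasing_submodules (zT _).
rewrite opprB addrA subrK; apply: completion_mod_ker_le (yz _); exact: leq_maxl.
Qed.

End LinearCompactness.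

(** * Homomorphisms into a module and into its completion *)

Section FiniteFunctions.
Variables (R : comPzRingType) (N : lmodType R) (d : nat).
Local Notation V := {ffun 'I_d -> N}.

Definition ffun_single (i : 'I_d) (x : N) : V := [ffun j => if j == i then x else 0].

Lemma ffun_sum_single (g : V) : g = \sum_i ffun_single i (g i).
Proof.
apply/ffunP => j; rewrite sum_ffunE (bigD1 j) //= ffunE eqxx big1 ?addr0 // => i ij.
by rewrite ffunE eq_sym (negbTE ij).
Qed.

Lemma ffun_fg : finitely_generated (full_submodule N) -> finitely_generated (full_submodule V).
Proof.
move=> [s sN]; apply/fg_subP; exists [seq ffun_single i x | i <- enum 'I_d, x <- s].
split=> // g _; rewrite [g]ffun_sum_single.
elim/big_ind: _ => [|a b|i _]; [exact: submod0|exact: submodD|].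
have @T : submodule N.
{ exists (fun x => span [set` [seq ffun_single i x | i <- enum 'I_d, x <- s]] (ffun_single i x)).
  - have -> : ffun_single i 0 = 0; last exact: submod0.
    by apply/ffunP => j; rewrite !ffunE if_same.
  - move=> x y Tx Ty; suff -> : ffun_single i (x + y) = ffun_single i x + ffun_single i y.
      exact: submodD.
    by apply/ffunP => j; rewrite !ffunE; case: ifP; rewrite ?addr0.
  - move=> r x Tx; suff -> : ffun_single i (r *: x) = r *: ffun_single i x by exact: submodZ.
    by apply/ffunP => j; rewrite !ffunE; case: ifP; rewrite ?scaler0. }
have : full_submodule N (g i) by [].
rewrite -sN; suff H : span [set` s] `<=` T by exact: H.
apply/span_subP => x xs; apply: mem_span; apply/allpairsP; exists (i, x).
by rewrite mem_enum.
Qed.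

Lemma ideal_smul_ffun (J : ideal R) (g : V) :
  ideal_smul J (full_submodule V) g <-> forall i, ideal_smul J (full_submodule N) (g i).
Proof.
split=> [Hg i|Hg].
  have @T : submodule V.
  { exists (fun g : V => ideal_smul J (full_submodule N) (g i)).
    - by rewrite ffunE; exact: submod0.
    - by move=> x y Tx Ty; rewrite ffunE; exact: submodD.
    - by move=> r x Tx; rewrite ffunE; exact: submodZ. }
  suff H : ideal_smul J (full_submodule V) `<=` T by exact: H.
  apply/ideal_smul_subP => r x Jr _.
  by rewrite -[submod_set _ _]/(ideal_smul J (full_submodule N) ((r *: x) i)) ffunE;
    exact: ideal_smul_mem.
rewrite [g]ffun_sum_single; elim/big_ind: _ => [|a b|i _]; [exact: submod0|exact: submodD|].
have @T : submodule N.
{ exists (fun x => ideal_smul J (full_submodule V) (ffun_single i x)).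
  - have -> : ffun_single i 0 = 0; last exact: submod0.
    by apply/ffunP => j; rewrite !ffunE if_same.
  - move=> x y Tx Ty; suff -> : ffun_single i (x + y) = ffun_single i x + ffun_single i y.
      exact: submodD.
    by apply/ffunP => j; rewrite !ffunE; case: ifP; rewrite ?addr0.
  - move=> r x Tx; suff -> : ffun_single i (r *: x) = r *: ffun_single i x by exact: submodZ.
    by apply/ffunP => j; rewrite !ffunE; case: ifP; rewrite ?scaler0. }
suff H : ideal_smul J (full_submodule N) `<=` T by exact: H.
apply/ideal_smul_subP => r x Jr _.
rewrite -[submod_set _ _]/(ideal_smul J (full_submodule V) (ffun_single i (r *: x))).
suff -> : ffun_single i (r *: x) = r *: ffun_single i x by exact: ideal_smul_mem.
by apply/ffunP => j; rewrite !ffunE; case: ifP; rewrite ?scaler0.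
Qed.

End FiniteFunctions.

Section SemilinearOn.
Variables (R S : comPzRingType) (f : {rmorphism R -> S}) (J : ideal R) (L : lmodType S).

(** A homomorphism from the ideal J, encoded as a total function whose values outside J are
    arbitrary. It is linear along f, as L is a module over S. *)
Definition semilinear_on (g : R -> L) :=
  forall a r t, J r -> J t -> g (a * r + t) = f a *: g r + g t.

Lemma semilinear_on0 g : semilinear_on g -> g 0 = 0.
Proof.
move=> glin; have := glin 1 0 0 (@submod0 _ R^o J) (@submod0 _ R^o J).
by rewrite mulr0 addr0 rmorph1 scale1r => /eqP; rewrite -subr_eq0 opprD addrA subrr add0r oppr_eq0 => /eqP.
Qed.

Lemma semilinear_on_sum g (I : Type) (s : seq I) (c r : I -> R) :
  semilinear_on g -> (forall i, J (r i)) ->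
  g (\sum_(i <- s) c i * r i) = \sum_(i <- s) f (c i) *: g (r i).
Proof.
move=> glin Jr.
suff [] : J (\sum_(i <- s) c i * r i) /\
    g (\sum_(i <- s) c i * r i) = \sum_(i <- s) f (c i) *: g (r i) by [].
elim: s => [|i s [Js IHs]].
  by rewrite !big_nil; split; [exact: (@submod0 _ R^o)|exact: semilinear_on0].
rewrite !big_cons glin // IHs; split=> //; apply: (@submodD _ R^o) => //.
exact: (@submodZ _ R^o).
Qed.

End SemilinearOn.

Section AdicCompletion.
Variables (R : comPzRingType) (m : ideal R).
Hypotheses (noethR : noetherian R) (R_local : local_ring m).
Variables (N : lmodType R) (S : comPzRingType) (f : {rmorphism R -> S}).
Hypothesis N_fg : finitely_generated (full_submodule N).
Variables (L : lmodType S) (kappa : {additive N -> L}) (F : nat -> submodule L).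
Local Notation mN n := (ideal_smul (ideal_pow m n) (full_submodule N)).
Hypotheses (kappaZ : forall r x, kappa (r *: x) = f r *: kappa x)
  (F_kappa : forall n x, F n (kappa x) <-> mN n x)
  (F_decr : forall n z, F n.+1 z -> F n z)
  (F_approx : forall z n, exists x, F n (z - kappa x))
  (F_separated : forall z, (forall n, F n z) -> z = 0)
  (F_complete : forall z : nat -> L, (forall n, F n (z n.+1 - z n)) ->
     exists y, forall n, F n (y - z n)).

Lemma local_unit1B (t : R) : m t -> exists u, u * (1 - t) = 1.
Proof.
move=> mt; apply: (local_ring_unit noethR R_local) => m1t.
have [[m1 _] _] := R_local; apply: m1.
by rewrite -[1](subrK t); exact: (@submodD _ R^o).
Qed.

Lemma F_le n k z : (n <= k)%N -> F k z -> F n z.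
Proof. by move=> /subnK <-; elim: (k - n)%N => // d IHd /F_decr. Qed.

Lemma kappa_inj x : kappa x = 0 -> x = 0.
Proof.
move=> kx; apply: (@submodule_closed R N noethR (noetherian_fg noethR N_fg) m
  (zero_submodule N) x local_unit1B) => n.
by exists 0 => //; rewrite subr0; apply/F_kappa; rewrite kx; exact: submod0.
Qed.

Section Generators.
Variables (k : nat) (s : seq R^o).
Hypothesis sk : span [set` s] = ideal_pow m k :> set R.
Local Notation d := (size s).
Local Notation V := {ffun 'I_d -> N}.
Local Notation r_ := (nth (0 : R) s).

Let mr (i : 'I_d) : ideal_pow m k (r_ i).
Proof. by rewrite -sk; apply: mem_span; exact: mem_nth. Qed.

Let mk_sum r : ideal_pow m k r -> exists c : 'I_d -> R, r = \sum_i c i * r_ i.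
Proof. by rewrite -sk => /span_sum. Qed.

Let V_noeth : noetherian_module V.
Proof. exact/noetherian_fg/ffun_fg. Qed.

(** For generators r_i of m^k, the tuple (r_i z) lies in N^d and is approximated by tuples (r_i w)
    with w in N. These form a submodule of N^d, which is closed, so (r_i z) = (r_i v) for some v in
    N. *)
Lemma torsion_quotient_split z :
  (forall r, ideal_pow m k r -> exists x, f r *: z = kappa x) ->
  exists v, forall r, ideal_pow m k r -> f r *: (z - kappa v) = 0.
Proof.
move=> Hz; have [|c Hc] := @choice 'I_d N (fun i x => f (r_ i) *: z = kappa x).
  by move=> i; exact: Hz.
have @C : submodule V.
{ exists (fun g : V => exists w, forall i, g i = r_ i *: w).
  - by exists 0 => i; rewrite ffunE scaler0.
  - by move=> x y [w xw] [u yu]; exists (w + u) => i; rewrite ffunE xw yu scalerDr.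
  - by move=> r x [w xw]; exists (r *: w) => i; rewrite ffunE xw !scalerA mulrC. }
have [n|w Hw] := @submodule_closed R V noethR V_noeth m C (finfun c) local_unit1B.
  have [w Hw] := F_approx z n.
  exists [ffun i : 'I_d => r_ i *: w]; first by exists w => i; rewrite ffunE.
  apply/ideal_smul_ffun => i; rewrite !ffunE; apply/F_kappa.
  rewrite raddfB /= -Hc kappaZ -scalerBr; exact: submodZ.
exists w => r /mk_sum[b ->]; rewrite rmorph_sum scaler_suml big1 // => i _.
rewrite rmorphM -scalerA; have := Hw i; rewrite ffunE scalerBr Hc => ->.
by rewrite kappaZ subrr scaler0.
Qed.

(** Hom(m^k, N), embedded in N^d by the values at the generators. This makes it a submodule of a
    Noetherian module, so Artin-Rees applies to it. *)
Let homs : submodule V.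
Proof.
exists (fun g : V => exists2 h : R -> N,
  semilinear_on (@idfun R) (ideal_pow m k) h & forall i, g i = h (r_ i)).
- by exists (fun=> 0) => [a r t _ _|i]; rewrite ?scaler0 ?addr0 ?ffunE.
- move=> x y [h hlin xh] [h' h'lin yh']; exists (fun r => h r + h' r) => [a r t Jr Jt|i].
    by rewrite hlin // h'lin // scalerDr addrACA.
  by rewrite ffunE xh yh'.
- move=> r x [h hlin xh]; exists (fun t => r *: h t) => [a t u Jt Ju|i].
    by rewrite hlin // scalerDr !scalerA mulrC.
  by rewrite ffunE xh.
Defined.

(* A homomorphism h and an element t of m^k satisfy t h = h(t) on m^k. *)
Let homs_smul j g : ideal_smul (ideal_pow m (j + k)) homs g ->
  exists2 w, mN j w & forall i, g i = r_ i *: w.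
Proof.
have @C : submodule V.
{ exists (fun g : V => exists2 w, mN j w & forall i, g i = r_ i *: w).
  - by exists 0 => [|i]; [exact: submod0|rewrite ffunE scaler0].
  - move=> x y [w jw xw] [u ju yu]; exists (w + u) => [|i]; first exact: submodD.
    by rewrite ffunE xw yu scalerDr.
  - move=> r x [w jw xw]; exists (r *: w) => [|i]; first exact: submodZ.
    by rewrite ffunE xw !scalerA mulrC. }
move=> /ideal_pow_smulD; suff HC : ideal_smul (ideal_pow m j) (ideal_smul (ideal_pow m k) homs) `<=` C.
  exact: HC.
apply/ideal_smul_subP => r x jr.
have @D : submodule V.
{ exists (fun g : V => exists w, forall i, g i = r_ i *: w).
  - by exists 0 => i; rewrite ffunE scaler0.
  - by move=> y z [w xw] [u yu]; exists (w + u) => i; rewrite ffunE xw yu scalerDr.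
  - by move=> t y [w xw]; exists (t *: w) => i; rewrite ffunE xw !scalerA mulrC. }
suff HD : ideal_smul (ideal_pow m k) homs `<=` D.
  move=> /HD[w xw]; exists (r *: w) => [|i]; first exact: ideal_smul_mem.
  by rewrite ffunE xw !scalerA mulrC.
apply/ideal_smul_subP => t y kt [h hlin yh]; exists (h t) => i.
have h0 := semilinear_on0 hlin.
have hZ a u : ideal_pow m k u -> h (a * u) = a *: h u.
  by move=> ku; rewrite -[a * u]addr0 hlin // ?h0 ?addr0 //; exact: (@submod0 _ R^o).
by rewrite ffunE yh -!hZ // mulrC.
Qed.

(** Hom(m^k, L) = Hom(m^k, N) + L. The map g is a limit of homomorphisms n_j into N. Consecutive
    ones differ by an element of m^(j + k) Hom(m^k, N), which by [homs_smul] is multiplication by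
    some w_j in m^j N. Then h = n_0, and w is the sum of the w_j in L. *)
Lemma hom_completion_split (g : R -> L) : semilinear_on f (ideal_pow m k) g ->
  exists w h, semilinear_on (@idfun R) (ideal_pow m k) h /\
    forall r, ideal_pow m k r -> g r = kappa (h r) + f r *: w.
Proof.
move=> glin.
(* Z is the module of relations between the generators of m^k. Its generators [zs] are the rows of
   the matrix [theta], whose kernel consists of tuples in [homs]. *)
have @Z : submodule {ffun 'I_d -> R^o}.
{ exists (fun c : {ffun 'I_d -> R^o} => \sum_i c i * r_ i = 0).
  - by rewrite big1 // => i _; rewrite ffunE mul0r.
  - move=> x y x0 y0; rewrite -[RHS](addr0 0) -[X in _ = X + _]x0 -[X in _ = _ + X]y0 -big_split.
    by apply: eq_bigr => i _; rewrite ffunE mulrDl.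
  - move=> a x x0; rewrite -[RHS](mulr0 a) -[X in _ = a * X]x0 mulr_sumr.
    by apply: eq_bigr => i _; rewrite ffunE mulrA. }
have R_fg : finitely_generated (full_submodule R^o) by exact: noethR.
have /fg_subP[zs [zsZ Zzs]] := noetherian_fg noethR (ffun_fg d R_fg) Z.
pose V' := {ffun 'I_(size zs) -> N}.
pose theta0 (v : V) : V' := [ffun j : 'I_(size zs) =>
  \sum_i ((zs`_j : {ffun 'I_d -> R^o}) i : R) *: v i].
have theta_lin : linear theta0.
  move=> a x y; apply/ffunP => j; rewrite !ffunE scaler_sumr -big_split.
  by apply: eq_bigr => i _; rewrite !ffunE scalerDr !scalerA mulrC.
pose thetaM := GRing.isLinear.Build R V V' *:%R theta0 theta_lin.
pose theta : {linear V -> V'} := HB.pack theta0 thetaM.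
have V'_noeth : noetherian_module V' by exact/noetherian_fg/ffun_fg.
have theta_ker v : theta v = 0 -> homs v.
  move=> /ffunP tv0.
  have rel (c : {ffun 'I_d -> R^o}) : Z c -> \sum_i c i *: v i = 0.
    move=> /Zzs; have @T : submodule {ffun 'I_d -> R^o}.
    { exists (fun c : {ffun 'I_d -> R^o} => \sum_i c i *: v i = 0).
      - by rewrite big1 // => i _; rewrite ffunE scale0r.
      - move=> x y x0 y0; rewrite -[RHS](addr0 0) -[X in _ = X + _]x0 -[X in _ = _ + X]y0 -big_split.
        by apply: eq_bigr => i _; rewrite ffunE scalerDl.
      - move=> a x x0; rewrite -[RHS](scaler0 _ a) -[X in _ = a *: X]x0 scaler_sumr.
        by apply: eq_bigr => i _; rewrite ffunE scalerA. }
    suff HT : span [set` zs] `<=` T by exact: HT.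
    apply/span_subP => _ /(nthP 0)[j jlt <-].
    by have := tv0 (Ordinal jlt); rewrite !ffunE.
  (* [b r] is an arbitrary expansion of r in the generators; by [rel] the value assigned to r does
     not depend on it. *)
  have [|b Hb] := @choice R ('I_d -> R) (fun r c => ideal_pow m k r -> r = \sum_i c i * r_ i).
    move=> r; have [/mk_sum[c Hc]|nr] := pselect (ideal_pow m k r); first by exists c.
    by exists (fun=> 0).
  have b_eq r (c : 'I_d -> R) : ideal_pow m k r -> r = \sum_i c i * r_ i ->
      \sum_i b r i *: v i = \sum_i c i *: v i.
    move=> kr rc; apply/eqP; rewrite -subr_eq0 -sumrB; apply/eqP.
    rewrite -[RHS](rel (finfun (fun i => b r i - c i))).
      by apply: eq_bigr => i _; rewrite ffunE scalerBl.
    rewrite -[submod_set _ _]/(\sum_i (finfun (fun i => b r i - c i)) i * r_ i = 0).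
    transitivity (\sum_i (b r i * r_ i - c i * r_ i)).
      by apply: eq_bigr => i _; rewrite ffunE mulrBl.
    by rewrite sumrB -rc -(Hb r kr) subrr.
  exists (fun r => \sum_i b r i *: v i) => [a r t kr kt|i].
    rewrite (b_eq (a * r + t) (fun i => a * b r i + b t i)).
    - by rewrite scaler_sumr -big_split; apply: eq_bigr => i _; rewrite scalerDl scalerA.
    - by apply: (@submodD _ R^o) => //; exact: (@submodZ _ R^o).
    - rewrite {1}(Hb r kr) {1}(Hb t kt) mulr_sumr -big_split.
      by apply: eq_bigr => i _; rewrite mulrDl mulrA.
  rewrite (b_eq (r_ i) (fun j => (j == i)%:R)) //.
    by rewrite (bigD1 i) //= eqxx scale1r big1 ?addr0 // => j /negbTE ->; rewrite scale0r.
  by rewrite (bigD1 i) //= eqxx mul1r big1 ?addr0 // => j /negbTE ->; rewrite mul0r.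
(* Artin-Rees for the image of theta: a value close to 0 is attained at a tuple close to 0. *)
have theta_ar q : exists l, forall v, ideal_smul (ideal_pow m l) (full_submodule V') (theta v) ->
    exists2 v', ideal_smul (ideal_pow m q) (full_submodule V) v' & theta v = theta v'.
  have [l Hl] := artin_rees noethR V'_noeth m (im_submodule theta) q.
  exists l => v lv; have /Hl : im_submodule theta (theta v) by exists v.
  move=> /(_ lv).
  have @T : submodule V'.
  { exists (fun y => exists2 v', ideal_smul (ideal_pow m q) (full_submodule V) v' & y = theta v').
    - by exists 0; [exact: submod0|rewrite linear0].
    - by move=> x y [x' qx ->] [y' qy ->]; exists (x' + y'); [exact: submodD|rewrite linearD].
    - by move=> a x [x' qx ->]; exists (a *: x'); [exact: submodZ|rewrite linearZ]. }
  suff HT : ideal_smul (ideal_pow m q) (im_submodule theta) `<=` T by exact: HT.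
  apply/ideal_smul_subP => a _ qa [u _ <-]; exists (a *: u); last by rewrite linearZ.
  exact: ideal_smul_mem.
(* A tuple in N close to the values of g nearly satisfies the relations, and a correction close to 0
   makes it satisfy them. *)
have dense q : exists2 n : V, homs n & forall i : 'I_d, F q (g (r_ i) - kappa (n i)).
  have [l Hl] := theta_ar q.
  have [|n0 Hn0] := @choice 'I_d N (fun i x => F (maxn l q) (g (r_ i) - kappa x)).
    by move=> i; exact: F_approx.
  have [|v' qv' tv'] := Hl (finfun n0).
    apply/ideal_smul_ffun => j; apply/F_kappa; apply: (F_le (leq_maxl l q)).
    rewrite ffunE raddf_sum /=.
    pose c i := (zs`_j : {ffun 'I_d -> R^o}) i : R.
    have c0 : \sum_i f (c i) *: g (r_ i) = 0.
      rewrite -(semilinear_on_sum _ _ glin) //.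
      have -> : \sum_i c i * r_ i = 0 by apply: zsZ; exact: mem_nth.
      exact: semilinear_on0 glin.
    have -> : \sum_i kappa (c i *: (finfun n0) i) =
        - \sum_i f (c i) *: (g (r_ i) - kappa (n0 i)).
      rewrite -[LHS]subr0 -[X in _ - X = _]c0 -sumrB -sumrN; apply: eq_bigr => i _.
      by rewrite kappaZ ffunE -scalerBr -scalerN opprB.
    apply: submodN; elim/big_ind: _ => [|x y|i _]; [exact: submod0|exact: submodD|].
    exact: submodZ.
  exists (finfun n0 - v'); first by apply: theta_ker; rewrite linearB tv' subrr.
  move=> i; rewrite !ffunE raddfB opprB addrCA addrC; apply: submodD.
    exact: F_le (leq_maxr l q) (Hn0 i).
  by apply/F_kappa; exact: (iffLR (ideal_smul_ffun _ _) qv').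
have /choice[l lP] : forall j, exists l, forall n,
    ideal_smul (ideal_pow m l) (full_submodule V) n -> homs n -> ideal_smul (ideal_pow m (j + k)) homs n.
  by move=> j; exact: artin_rees.
(* The difference of n_(j + 1) and n_j needs precision [l j] from both: [l j] serves the index j,
   and [l j.-1] the index j + 1. The summand j makes n_j converge to g. *)
pose lam j := (l j + l j.-1 + j)%N.
have /choice[n_ n_P] : forall j, exists n : V, homs n /\ forall i : 'I_d, F (lam j) (g (r_ i) - kappa (n i)).
  by move=> j; have [n Hn Fn] := dense (lam j); exists n.
have /choice[w_ w_P] : forall j, exists w, mN j w /\
    forall i, n_ j.+1 i - n_ j i = r_ i *: w.
  move=> j; have [|w jw Hw] := @homs_smul j (n_ j.+1 - n_ j).
    apply: lP; last by apply: submodB; exact: (n_P _).1.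
    apply/ideal_smul_ffun => i; apply/F_kappa; rewrite !ffunE raddfB.
    rewrite -[_ - _](subrKA (g (r_ i))) -[_ - g _]opprB addrC; apply: submodB.
      apply: F_le ((n_P j).2 i); by rewrite /lam -addnA leq_addr.
    by apply: F_le ((n_P j.+1).2 i); rewrite /lam /= addnAC leq_addl.
  by exists w; split=> // i; have := Hw i; rewrite !ffunE.
have [|w Hw] := F_complete (z := fun n => kappa (\sum_(j < n) w_ j)).
  move=> n; rewrite -raddfB big_ord_recr /= addrAC subrr add0r.
  by apply/F_kappa; exact: (w_P n).1.
have [h hlin n0h] := (n_P 0%N).1.
exists w, h; split=> //.
have n_sum n i : n_ n i = h (r_ i) + r_ i *: \sum_(j < n) w_ j.
  elim: n => [|n IHn]; first by rewrite big_ord0 scaler0 addr0.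
  by rewrite big_ord_recr /= scalerDr addrA -IHn -(w_P n).2 addrC subrK.
have g_r (i : 'I_d) : g (r_ i) = kappa (h (r_ i)) + f (r_ i) *: w.
  apply/eqP; rewrite -subr_eq0; apply/eqP; apply: F_separated => n.
  have -> : g (r_ i) - (kappa (h (r_ i)) + f (r_ i) *: w) =
      (g (r_ i) - kappa (n_ n i)) - f (r_ i) *: (w - kappa (\sum_(j < n) w_ j)).
    by rewrite n_sum (raddfD kappa) kappaZ scalerBr !opprD opprK !addrA [RHS]addrAC subrK.
  apply: submodB; last exact: submodZ.
  by apply: F_le ((n_P n).2 i); rewrite /lam leq_addl.
move=> r /mk_sum[c ->].
rewrite (semilinear_on_sum _ _ glin) // (semilinear_on_sum _ _ hlin) //.
rewrite raddf_sum rmorph_sum scaler_suml -big_split /=; apply: eq_bigr => i _.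
by rewrite g_r scalerDr kappaZ rmorphM scalerA.
Qed.

End Generators.
End AdicCompletion.

(** * M^/a^n M^ as the m-adic completion of M/a^n M *)

Section AdicQuotientCompletion.
Variables (R : comPzRingType) (m a : ideal R) (M : lmodType R).
Hypotheses (noethR : noetherian R) (R_local : local_ring m)
  (M_fg : finitely_generated (full_submodule M)).
Local Notation S := (completion_ring m).
Local Notation Mc := (completion m M).
Local Notation K := (@completion_mod_ker R m M).

Definition ext_smul n : submodule Mc :=
  ideal_smul (ideal_pow (ideal_ext m a) n) (full_submodule Mc).

Definition ext_quotient n : lmodType S := quotmod (ext_smul n).

Lemma ext_smulS n : ext_smul n.+1 `<=` ext_smul n.
Proof. by apply: ideal_smul_mono => //; exact: ideal_powS. Qed.

Section Level.
Variable n : nat.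
Local Notation N := (adic_quotient a M n).
Local Notation L := (ext_quotient n).
Local Notation aM := (ideal_smul (ideal_pow a n) (full_submodule M)).

Definition to_ext_quotient (x : N) : L :=
  \pi_(quotmod (ext_smul n)) (completion_mod m (repr (x : quotmod aM))).

Lemma to_ext_quotientE (x : M) :
  to_ext_quotient (\pi_(quotmod aM) x) = \pi_(quotmod (ext_smul n)) (completion_mod m x).
Proof.
apply/quotmodP; rewrite -raddfB; apply: ideal_ext_smul_of => //.
exact: quotmod_repr.
Qed.

Lemma to_ext_quotientB : {morph to_ext_quotient : x y / x - y}.
Proof.
move=> x y; rewrite -[x]reprK -[y]reprK -quotmod_piB !to_ext_quotientE.
by rewrite raddfB quotmod_piB.
Qed.

HB.instance Definition _ :=
  GRing.isZmodMorphism.Build N L to_ext_quotient to_ext_quotientB.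

Lemma to_ext_quotientZ r x :
  to_ext_quotient (r *: x) = completion_of m r *: to_ext_quotient x.
Proof.
rewrite -[x]reprK -quotmod_piZ !to_ext_quotientE -quotmod_piZ.
by rewrite completion_modZ.
Qed.

Lemma adic_quotient_fg : finitely_generated (full_submodule N).
Proof.
pose piL := GRing.isLinear.Build R M N *:%R (fun x : M => \pi_(quotmod aM) x : N)
  (fun r x y => etrans (quotmod_piD aM (r *: x) y) (congr1 (fun z => z + _) (quotmod_piZ aM r x))).
pose pi : {linear M -> N} := HB.pack (fun x : M => \pi_(quotmod aM) x : N) piL.
apply: (@fg_surj R M N pi) => // y; exists (repr (y : quotmod aM)).
by rewrite /= reprK.
Qed.

(** The image of [K l], so that approximation and completeness descend from M^. *)
Definition ext_ker (l : nat) : submodule L.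
Proof.
exists (fun z => exists2 X, K l X & z = \pi_(quotmod (ext_smul n)) X).
- by exists 0; [exact: submod0|apply/esym/quotmod_pi_eq0; exact: submod0].
- move=> _ _ [X KX ->] [Y KY ->]; exists (X + Y); first exact: submodD.
  by rewrite quotmod_piD.
- move=> s _ [X KX ->]; exists (s *: X); first exact: submodZ.
  by rewrite quotmod_piZ.
Defined.

Lemma ext_ker_pi l X : K l X -> ext_ker l (\pi_(quotmod (ext_smul n)) X).
Proof. by exists X. Qed.

Lemma ideal_smul_quot (V : lmodType R) (T : submodule V) (J : ideal R) x :
  ideal_smul J (full_submodule (quotmod T)) (\pi_(quotmod T) x) <->
  exists2 y, ideal_smul J (full_submodule V) y & T (x - y).
Proof.
split.
  have @U : submodule (quotmod T).
  { exists (fun z => exists2 y, ideal_smul J (full_submodule V) y & z = \pi_(quotmod T) y).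
    - by exists 0; [exact: submod0|apply/esym/quotmod_pi_eq0; exact: submod0].
    - move=> _ _ [y Jy ->] [z Jz ->]; exists (y + z); first exact: submodD.
      by rewrite quotmod_piD.
    - move=> s _ [y Jy ->]; exists (s *: y); first exact: submodZ.
      by rewrite quotmod_piZ. }
  suff H : ideal_smul J (full_submodule (quotmod T)) `<=` U.
    by move=> /H[y Jy xy]; exists y => //; apply/quotmodP.
  apply/ideal_smul_subP => r z Jr _; exists (r *: repr z); first exact: ideal_smul_mem.
  by rewrite quotmod_piZ reprK.
move=> [y Jy /quotmodP ->].
have @U : submodule V.
{ exists (fun y => ideal_smul J (full_submodule (quotmod T)) (\pi_(quotmod T) y)).
  - by rewrite (iffRL (@quotmod_pi_eq0 _ _ T 0) (submod0 _)); exact: submod0.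
  - by move=> u v Uu Uv; rewrite quotmod_piD; exact: submodD.
  - by move=> r u Uu; rewrite quotmod_piZ; exact: submodZ. }
suff H : ideal_smul J (full_submodule V) `<=` U by exact: H.
apply/ideal_smul_subP => r z Jr _.
rewrite -[submod_set _ _]/(ideal_smul J (full_submodule (quotmod T)) (\pi_(quotmod T) (r *: z))).
by rewrite quotmod_piZ; exact: ideal_smul_mem.
Qed.

(** If x lies in K l + a^n M^, density replaces the second part by an element of a^n M modulo K l,
    and K l meets M in m^l M. *)
Lemma ext_ker_to_ext_quotient l x :
  ext_ker l (to_ext_quotient x) <-> ideal_smul (ideal_pow m l) (full_submodule N) x.
Proof.
rewrite -[x]reprK to_ext_quotientE; move: (repr _) => {}x.
split=> [[X KX /quotmodP Hx]|/ideal_smul_quot[y my xy]].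
  apply/ideal_smul_quot.
  have [y ay Ky] := ideal_ext_smul_approx l Hx.
  exists (x - y); last by rewrite opprB addrC subrK.
  apply/(@completion_mod_ker_of R m M); rewrite raddfB.
  suff -> : completion_mod m x - completion_mod m y =
    (completion_mod m x - X - completion_mod m y) + X by exact: submodD.
  by rewrite [RHS]addrAC subrK.
exists (completion_mod m y); first exact/completion_mod_ker_of.
by apply/quotmodP; rewrite -raddfB; exact: ideal_ext_smul_of.
Qed.

Lemma ext_kerS l z : ext_ker l.+1 z -> ext_ker l z.
Proof. by move=> [X KX ->]; apply: ext_ker_pi; exact: completion_mod_kerS. Qed.

Lemma ext_ker_approx z l : exists x, ext_ker l (z - to_ext_quotient x).
Proof.
have [x Hx] := completion_mod_approx (repr (z : quotmod (ext_smul n))) l.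
exists (\pi_(quotmod aM) x); rewrite to_ext_quotientE -[z]reprK -quotmod_piB.
exact: ext_ker_pi.
Qed.

(** This says that a^n M^ is closed in M^. *)
Lemma ext_ker_separated z : (forall l, ext_ker l z) -> z = 0.
Proof.
rewrite -[z]reprK; move: (repr _) => {}z Hz; apply/quotmod_pi_eq0.
apply: (completion_mod_closed noethR R_local M_fg) => l.
have [X KX /quotmodP zX] := Hz l; exists (z - X) => //.
by rewrite opprB addrC subrK.
Qed.

Lemma ext_ker_complete (z : nat -> L) :
  (forall l, ext_ker l (z l.+1 - z l)) -> exists y, forall l, ext_ker l (y - z l).
Proof.
move=> Hz; have [|e He] := @choice nat Mc (fun l X =>
    K l X /\ z l.+1 - z l = \pi_(quotmod (ext_smul n)) X).
  by move=> l; have [X KX zX] := Hz l; exists X.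
pose Z l := repr (z 0%N : quotmod (ext_smul n)) + \sum_(j < l) e j.
have Zz l : z l = \pi_(quotmod (ext_smul n)) (Z l).
  elim: l => [|l IHl]; first by rewrite /Z big_ord0 addr0 reprK.
  by rewrite -[LHS](subrK (z l)) (He l).2 IHl -quotmod_piD [e l + _]addrC /Z big_ord_recr /= addrA.
have [|Y HY] := @completion_mod_complete R m M Z.
  by move=> l; rewrite /Z big_ord_recr /= opprD addrACA subrr add0r addrAC subrr add0r; exact: (He l).1.
exists (\pi_(quotmod (ext_smul n)) Y) => l; rewrite Zz -quotmod_piB.
exact: ext_ker_pi.
Qed.

End Level.

Definition ext_proj n (z : ext_quotient n.+1) : ext_quotient n :=
  \pi_(quotmod (ext_smul n)) (repr (z : quotmod (ext_smul n.+1))).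

Lemma ext_projE n X :
  ext_proj (\pi_(quotmod (ext_smul n.+1)) X) = \pi_(quotmod (ext_smul n)) X.
Proof. by apply/quotmodP; apply: ext_smulS; exact: quotmod_repr. Qed.

Lemma ext_proj_linear n : linear (@ext_proj n).
Proof.
move=> s z t; rewrite -[z]reprK -[t]reprK -quotmod_piZ -quotmod_piD !ext_projE.
by rewrite quotmod_piD quotmod_piZ.
Qed.

HB.instance Definition _ n := GRing.isLinear.Build S (ext_quotient n.+1) (ext_quotient n)
  *:%R (@ext_proj n) (@ext_proj_linear n).

Lemma ext_proj_to_ext_quotient n (x : adic_quotient a M n.+1) :
  ext_proj (to_ext_quotient x) = to_ext_quotient (@adic_proj R a M n x).
Proof. by rewrite -[x]reprK to_ext_quotientE ext_projE adic_projE to_ext_quotientE. Qed.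

End AdicQuotientCompletion.

(** * Classes in first local cohomology *)

Section FirstLocalCohomology.
Variables (R : comPzRingType) (m : ideal R).

Definition submod_elt (V : lmodType R) (T : submodule V) x (Tx : T x) : submod_type T :=
  exist _ x (asboolT Tx).

Lemma submod_typeP (V : lmodType R) (T : submodule V) (y : submod_type T) : T (val y).
Proof. exact/submod_predP/(valP y). Qed.

Section Class.
Variables (N : lmodType R) (E : injective_resolution N).

(** H^1_m(N) is the m-torsion of E^0/N modulo the image of the m-torsion of E^0. An e that m^k
    multiplies into N represents such a torsion element. *)
Lemma torsion_cdiff (e : E 0%N) k :
  (forall r, ideal_pow m k r -> exists h, r *: e = res_aug E h) ->
  torsion m (E 1%N) (cdiff E 0%N e).
Proof.
move=> He; exists k => r /He[h rh]; rewrite -linearZ rh.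
by apply/res_exact0; exists h.
Qed.

Lemma cdiff_cocycle (e : E 0%N) (te : torsion m (E 1%N) (cdiff E 0%N e)) :
  cocycles (torsion_cochain m E) 1%N (submod_elt te).
Proof. by apply: val_inj; exact: cdiff2. Qed.

(* The class in H^1 of the extension of N generated by e. *)
Definition cdiff_class (e : E 0%N) (te : torsion m (E 1%N) (cdiff E 0%N e)) :
    local_cohomology m E 1%N :=
  \pi_(quotmod (restrict_submodule (cocycles (torsion_cochain m E) 1%N)
    (coboundaries (torsion_cochain m E) 1%N))) (submod_elt (cdiff_cocycle te)).

Lemma cdiff_class_eq (e1 e2 t : E 0%N) (v : N)
    (te1 : torsion m (E 1%N) (cdiff E 0%N e1)) (te2 : torsion m (E 1%N) (cdiff E 0%N e2)) :
  torsion m (E 0%N) t -> e1 - e2 = t + res_aug E v -> cdiff_class te1 = cdiff_class te2.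
Proof.
move=> tt e12; apply/quotmodP; exists (submod_elt tt) => //.
apply: val_inj; rewrite /= -linearB e12 linearD.
by have -> : cdiff E 0%N (res_aug E v) = 0; [apply/res_exact0; exists v|rewrite addr0].
Qed.

Lemma cdiff_class_eq0 (e : E 0%N) (te : torsion m (E 1%N) (cdiff E 0%N e)) :
  cdiff_class te = 0 ->
  exists t v, torsion m (E 0%N) t /\ e = t + res_aug E v.
Proof.
move=> /quotmod_pi_eq0[[t tt] _ /(congr1 val) /= dt].
have /res_exact0[v _ ve] : cdiff E 0%N (e - t) = 0 by rewrite linearB dt subrr.
exists t, v; split; first exact/asboolP.
by rewrite ve addrC subrK.
Qed.

End Class.

Lemma cdiff_class_map (N N' : lmodType R) (g : {linear N -> N'})
    (E : injective_resolution N) (E' : injective_resolution N')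
    (phi : resolution_map g E E') (e : E 0%N)
    (te : torsion m (E 1%N) (cdiff E 0%N e))
    (te' : torsion m (E' 1%N) (cdiff E' 0%N (phi 0%N e))) :
  local_cohomology_map m phi 1%N (cdiff_class te) = cdiff_class te'.
Proof.
rewrite /local_cohomology_map /cohomology_map /cdiff_class [LHS]quotmod_mapE.
congr (\pi_(quotmod _) _); apply: val_inj; apply: val_inj.
exact: cmapP.
Qed.

End FirstLocalCohomology.

Lemma prime_exp (A : comPzRingType) (q : Spec A) (t : A) n : q (t ^+ n) -> q t.
Proof.
elim: n => [|n IHn]; first by move/prime_proper.
by rewrite exprS => /prime_mul[].
Qed.

Lemma ideal_pow_mem (A : comPzRingType) (I : ideal A) n : ideal_pow I n.+1 `<=` I.
Proof.
apply/ideal_smul_subP => r t Ir _.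
by rewrite /GRing.scale /= mulrC; exact: (@submodZ _ A^o).
Qed.

(** * Gluing along a disconnection *)

Section Gluing.
Variables (R : comPzRingType) (m a : ideal R) (M : lmodType R).
Hypotheses (noethR : noetherian R) (R_local : local_ring m)
  (M_fg : finitely_generated (full_submodule M)).
Local Notation S := (completion_ring m).
Local Notation mS := (completion_ideal m).
Local Notation Mc := (completion m M).
Local Notation rho := (completion_of m).
Local Notation T n := (@ext_smul R m a M n).
Local Notation N n := (adic_quotient a M n).
Local Notation L n := (@ext_quotient R m a M n).
Local Notation pi n := (\pi_(quotmod (T n))).
Local Notation kappa n := (@to_ext_quotient R m a M n).
Variables (x : Mc) (p : Spec S) (b c : ideal S).
Hypotheses (px : forall s, p s -> s *: x = 0)
  (bc_cover : forall q : Spec S, submodule_sum (ideal_ext m a) p `<=` q ->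
     b `<=` q \/ c `<=` q)
  (bc_meet : forall q : Spec S, b `<=` q -> c `<=` q -> mS `<=` q).
Let noethS := completion_noetherian noethR R_local.
Variable E : forall n, injective_resolution (N n).

(* The pair (e, w) represents, up to m-torsion, the section of the ideal
   transform of M^/a^n M^ that equals x near V(c) and 0 near V(b): its product
   with r is kappa h + r w, where r e = h. *)
Definition glued n (e : E n 0%N) (w : L n) := exists k, forall r, ideal_pow m k r ->
  exists h : N n, [/\ r *: e = res_aug (E n) h,
    forall s, ideal_pow b k s -> s *: (kappa n h + rho r *: w) = 0
    & forall s, ideal_pow c k s -> s *: (rho r *: pi n x - (kappa n h + rho r *: w)) = 0].

(** A prime over (aS)^n + p contains aS + p, hence b or c. So a power of bc lies in (aS)^n + p, and
    p kills x. *)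
Lemma bc_pow n : exists k, forall s t, ideal_pow b k s -> ideal_pow c k t ->
  T n ((s * t) *: x).
Proof.
have [q Jq|k Hk] := @radical_pow S noethS (ideal_smul b c)
    (submodule_sum (ideal_pow (ideal_ext m a) n) p).
  have aq : ideal_ext m a `<=` q.
    move=> t at_; apply: (@prime_exp _ _ _ n); apply/Jq/submodule_suml.
    exact: ideal_powX.
  have [|bq|cq] := bc_cover (q := q).
  - apply: submodule_sum_sub => // t pt; apply/Jq; exact: submodule_sumr.
  - apply/ideal_smul_subP => s t /bq qs _; rewrite /GRing.scale /= mulrC.
    exact: (@submodZ _ S^o).
  - by apply/ideal_smul_subP => s t _ /cq qt; exact: (@submodZ _ S^o).
exists k => s t bs ct.
have /Hk/submodule_sumP[y ay py] := ideal_pow_smul bs ct.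
rewrite -[s * t](subrK y) scalerDl px // add0r; exact: ideal_smul_mem.
Qed.

(** A prime over b' + c' contains b and c, hence mS. Only powers of single elements are asked for,
    so that powers of powers of b qualify. *)
Lemma m_sub_pow_sum (b' c' : ideal S) k l : (forall s, b s -> b' (s ^+ k)) ->
  (forall s, c s -> c' (s ^+ l)) ->
  exists j, forall r, ideal_pow m j r -> submodule_sum b' c' (rho r).
Proof.
move=> bb' cc'; have [q Jq|j Hj] := @radical_pow S noethS mS (submodule_sum b' c').
  apply: bc_meet => s.
  - by move=> /bb' b's; apply: (@prime_exp _ _ _ k); apply/Jq/submodule_suml.
  - by move=> /cc' c's; apply: (@prime_exp _ _ _ l); apply/Jq/submodule_sumr.
by exists j => r mr; apply: Hj; exact: completion_ideal_of_pow.
Qed.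

(** Write r in m^k as a sum of an element of b2 and an element u(r) of c1, both powers of b and c.
    The section is r |-> u(r) x: powers of b kill it modulo a^n M^, and powers of c kill its
    difference from r x. *)
Lemma glued_exists n : exists e w, @glued n e w.
Proof.
have [k1 Hbc] := bc_pow n.
pose b1 := ideal_pow b k1; pose c1 := ideal_pow c k1.
have b1c1x s : ideal_smul b1 c1 s -> T n (s *: x).
  suff H : ideal_smul b1 c1 `<=` ideal_colon (T n) x by exact: H.
  by apply/ideal_smul_subP => t u bt cu; exact: Hbc.
(* The power b1^n2 meets c1 inside b1 c1, which multiplies x into a^n M^. So u(r) x is determined
   modulo a^n M^. *)
have [n2 Hn2] := @artin_rees_weak S S^o noethS noethS b1 (ideal_smul b1 c1) c1
  (@ideal_smul_sub _ _ _ _) (fun _ h => h).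
(* The exponent is n2 + 1 so that b2 also lies in b1, even for n2 = 0. *)
pose b2 := ideal_pow b1 n2.+1.
have [|s|k Hk] := @m_sub_pow_sum b2 c1 (k1 * n2.+1)%N k1.
- by move=> s bs; rewrite exprM; do 2!apply: ideal_powX.
- by move=> cs; exact: ideal_powX.
have [|u Hu] := @choice R S (fun r u => ideal_pow m k r -> c1 u /\ b2 (rho r - u)).
  move=> r; have [/Hk/submodule_sumP[v bv cv]|nr] := pselect (ideal_pow m k r); last by exists 0.
  by exists (rho r - v) => _; split=> //; rewrite opprB addrC subrK.
(* The defect of linearity of u lies in both b2 and c1. *)
have glin : semilinear_on (completion_of m) (ideal_pow m k) (fun r => pi n (u r *: x) : L n).
  move=> d r t kr kt /=; rewrite -quotmod_piZ -quotmod_piD; apply/quotmodP.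
  rewrite scalerA -scalerDl -scalerBl; apply: b1c1x.
  have [cr br] := Hu _ kr; have [ct bt] := Hu _ kt.
  have [cdrt bdrt] : c1 (u (d * r + t)) /\ b2 (rho (d * r + t) - u (d * r + t)).
    by apply: Hu; apply: (@submodD _ R^o) => //; exact: (@submodZ _ R^o).
  apply: Hn2.
    have bz : b2 (u (d * r + t) - (rho d * u r + u t)).
      have -> : u (d * r + t) - (rho d * u r + u t) =
          (rho d * (rho r - u r) + (rho t - u t)) - (rho (d * r + t) - u (d * r + t)).
        rewrite rmorphD rmorphM mulrBr addrACA -opprD opprB [RHS]addrC.
        by rewrite addrA [X in _ = X + _]subrK.
      apply: (@submodB _ S^o) => //; apply: (@submodD _ S^o) => //.
      exact: (@submodZ _ S^o).
    rewrite -[_ - _]mulr1; apply: (@ideal_smul_mem _ S^o) => //.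
    exact: ideal_powS bz.
  apply: (@submodB _ S^o) => //; apply: (@submodD _ S^o) => //.
  exact: (@submodZ _ S^o).
have [s sk] := noethR (ideal_pow m k).
have [w [h [hlin gh]]] := @hom_completion_split R m noethR (N n) S (completion_of m)
  (adic_quotient_fg a M_fg n) (L n) (kappa n) (@ext_ker R m a M n)
  (@to_ext_quotientZ R m a M n) (@ext_ker_to_ext_quotient R m a M n)
  (@ext_kerS R m a M n) (@ext_ker_approx R m a M n)
  (@ext_ker_separated R m a M noethR R_local M_fg n)
  (@ext_ker_complete R m a M n) k s sk _ glin.
pose mk : lmodType R := submod_type (ideal_pow m k).
pose g0 (r : mk) : E n 0%N := res_aug (E n) (h (val r)).
have g0_lin : linear g0.
  move=> d r t; rewrite /g0 -linearP; congr (res_aug _ _).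
  rewrite [val _]linearP; apply: hlin; exact: submod_typeP.
pose g : {linear mk -> E n 0%N} := HB.pack g0 (GRing.isLinear.Build R mk _ *:%R g0 g0_lin).
have [hext Hext] := @res_injective R (N n) (E n) 0%N mk R^o
  (val : {linear submod_type (ideal_pow m k) -> R^o}) g val_inj.
(* [hext] extends h from m^k to R by injectivity, so r times [hext 1] is h r. *)
exists (hext 1), w, (maxn k k1) => r mr.
have kr : ideal_pow m k r by apply: ideal_pow_le mr; exact: leq_maxl.
have [cr br] := Hu r kr.
exists (h r); split=> [|t bt|t ct].
- rewrite -linearZ; have -> : r *: (1 : R^o) = r by exact: mulr1.
  exact: (Hext (submod_elt kr)).
- rewrite -gh // -quotmod_piZ scalerA; apply/quotmod_pi_eq0/Hbc => //.
  by apply: ideal_pow_le bt; exact: leq_maxr.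
- rewrite -gh // -quotmod_piZ -quotmod_piB -quotmod_piZ -scalerBl scalerA mulrC.
  apply/quotmod_pi_eq0/Hbc; first exact: ideal_pow_mem br.
  by apply: ideal_pow_le ct; exact: leq_maxr.
Qed.

(** Powers of b and of c, hence a power of m, kill the difference of the two sections. So a power of
    m multiplies w1 - w2 into M/a^n M, and [torsion_quotient_split] gives v with w1 - w2 - v
    torsion; then e1 - e2 + v is torsion as well. *)
Lemma glued_unique n e1 e2 w1 w2 : @glued n e1 w1 -> @glued n e2 w2 ->
  exists t v, torsion m (E n 0%N) t /\ e1 - e2 = t + res_aug (E n) v.
Proof.
move=> [k1 H1] [k2 H2]; pose k := maxn k1 k2.
have [|s|j Hj] := @m_sub_pow_sum (ideal_pow b k) (ideal_pow c k) k k.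
- by move=> s; exact: ideal_powX.
- exact: ideal_powX.
pose e := e1 - e2; pose W := w1 - w2.
have rel r : ideal_pow m (j + k) r ->
    exists h, r *: e = res_aug (E n) h /\ kappa n h + rho r *: W = 0.
  move=> /ideal_powD_smul.
  have @D : ideal R.
  { apply: (@Submodule R R^o (fun r : R =>
      exists h, r *: e = res_aug (E n) h /\ kappa n h + rho r *: W = 0)).
    - by exists 0; rewrite scale0r linear0 raddf0 add0r [rho 0]rmorph0 scale0r.
    - move=> r1 r2 [h1 [rh1 kh1]] [h2 [rh2 kh2]]; exists (h1 + h2).
      by rewrite scalerDl rh1 rh2 linearD raddfD [rho _]rmorphD scalerDl addrACA kh1 kh2 addr0.
    - move=> d r1 [h1 [rh1 kh1]]; exists (d *: h1); rewrite linearZ /= -rh1 scalerA; split=> //.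
      have -> : rho (d *: r1) = rho d * rho r1 by exact: rmorphM.
      by rewrite to_ext_quotientZ -scalerA -scalerDr kh1 scaler0. }
  suff HD : ideal_smul (ideal_pow m j) (ideal_pow m k) `<=` D by exact: HD.
  apply/ideal_smul_subP => r' {}r jr' kr.
  have [|h1 [rh1 bh1 ch1]] := H1 r; first by apply: ideal_pow_le kr; exact: leq_maxl.
  have [|h2 [rh2 bh2 ch2]] := H2 r; first by apply: ideal_pow_le kr; exact: leq_maxr.
  exists (r' *: (h1 - h2)); split.
    by rewrite -scalerA scalerBr rh1 rh2 -linearB linearZ.
  have -> : rho (r' *: r) = rho r' * rho r by exact: rmorphM.
  rewrite to_ext_quotientZ -scalerA -scalerDr raddfB scalerBr addrACA -opprD.
  have [s bs cs] := iffLR (submodule_sumP _ _ _) (Hj r' jr').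
  set D1 := kappa n h1 + rho r *: w1; set D2 := kappa n h2 + rho r *: w2.
  rewrite -[rho r'](subrK s) scalerDl scalerBr [s *: (_ - _)]scalerBr.
  have bD1 : s *: D1 = 0 by apply: bh1; apply: ideal_pow_le bs; exact: leq_maxl.
  have bD2 : s *: D2 = 0 by apply: bh2; apply: ideal_pow_le bs; exact: leq_maxr.
  have cD1 : (rho r' - s) *: (rho r *: pi n x - D1) = 0.
    by apply: ch1; apply: ideal_pow_le cs; exact: leq_maxl.
  have cD2 : (rho r' - s) *: (rho r *: pi n x - D2) = 0.
    by apply: ch2; apply: ideal_pow_le cs; exact: leq_maxr.
  rewrite bD1 bD2 subrr addr0 -scalerBr.
  have -> : D1 - D2 = (rho r *: pi n x - D2) - (rho r *: pi n x - D1).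
    by rewrite opprB [RHS]addrC addrA subrK.
  by rewrite scalerBr cD1 cD2 subrr.
have [s sk] := noethR (ideal_pow m (j + k)).
have [|v Hv] := @torsion_quotient_split R m noethR R_local (N n) S (completion_of m)
  (adic_quotient_fg a M_fg n) (L n) (kappa n) (@ext_ker R m a M n)
  (@to_ext_quotientZ R m a M n) (@ext_ker_to_ext_quotient R m a M n)
  (@ext_ker_approx R m a M n) (j + k)%N s sk W.
  move=> r /rel[h [_ kh]]; exists (- h).
  by rewrite raddfN; apply/eqP; rewrite -addr_eq0 addrC kh.
exists (e + res_aug (E n) v), (- v); split; last by rewrite linearN addrK.
exists (j + k)%N => r mr; have [h [rh kh]] := rel r mr.
rewrite scalerDr rh -linearZ -linearD.
suff -> : h + r *: v = 0 by rewrite linear0.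
apply: (@kappa_inj R m noethR R_local (N n) S (adic_quotient_fg a M_fg n) (L n)
  (kappa n) (@ext_ker R m a M n) (@ext_ker_to_ext_quotient R m a M n)).
rewrite raddfD /= to_ext_quotientZ -kh; congr (_ + _).
by apply/esym/eqP; rewrite -subr_eq0 -scalerBr Hv.
Qed.

Variable phi : forall n, resolution_map (@adic_proj R a M n) (E n.+1) (E n).
Hypothesis lim1_vanishes : forall z : formal_local_cohomology m phi 1%N, z = 0.

Lemma glued_map n e w : @glued n.+1 e w -> @glued n (phi n 0%N e) (ext_proj w).
Proof.
move=> [k Hk]; exists k => r kr; have [h [rh bh ch]] := Hk r kr.
exists (@adic_proj R a M n h); split=> [|s bs|s cs].
- by rewrite -linearZ rh res_mapP.
- by rewrite -ext_proj_to_ext_quotient -linearZ -linearD -linearZ /= bh // linear0.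
- rewrite -ext_proj_to_ext_quotient -(@ext_projE R m a M n x).
  by rewrite -!linearZ -linearD -linearB -linearZ /= ch // linear0.
Qed.

Lemma glued_torsion n e w : @glued n e w -> torsion m (E n 1%N) (cdiff (E n) 0%N e).
Proof.
by move=> [k Hk]; apply: (torsion_cdiff (k := k)) => r /Hk[h [rh _ _]]; exists h.
Qed.

(** Modulo a^n M^ the section is given by y itself; the factor r absorbs m-torsion. *)
Definition near_glued n y := exists k, forall r, ideal_pow m k r ->
  (forall s, ideal_pow b k s -> T n ((s * rho r) *: y)) /\
  (forall s, ideal_pow c k s -> T n ((s * rho r) *: (x - y))).

Lemma near_glued_exists n : exists y, near_glued n y.
Proof.
pose e k : E k 0%N := sval (cid (glued_exists k)).
pose w k : L k := sval (cid (svalP (cid (glued_exists k)))).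
have ew k : glued (e k) (w k) := svalP (cid (svalP (cid (glued_exists k)))).
pose z k := cdiff_class (glued_torsion (ew k)).
have zP k : local_cohomology_map m (phi k) 1%N (z k.+1) = z k.
  (* The choices at levels k and k + 1 are unrelated; their classes still match, by uniqueness at
     level k. *)
  rewrite (cdiff_class_map _ (glued_torsion (glued_map (ew k.+1)))).
  have [t [v [tt etv]]] := glued_unique (glued_map (ew k.+1)) (ew k).
  exact: cdiff_class_eq tt etv.
have /cdiff_class_eq0[t [v [[k2 tt] etv]]] : z n = 0.
  exact: (congr1 (fun u => invlim_fun u n) (lim1_vanishes (InvLim zP))).
have [k1 Hk1] := ew n.
exists (repr (kappa n v + w n : quotmod (T n))), (maxn k1 k2) => r kr.
have [|h [rh bh ch]] := Hk1 r; first by apply: ideal_pow_le kr; exact: leq_maxl.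
(* With e = t + v and r killing t, the section kappa h + r w becomes r (kappa v + w), so a lift of
   kappa v + w is the required y. *)
have {rh} hv : h = r *: v.
  apply: (@res_aug_inj _ _ (E n)); rewrite -rh etv scalerDr tt ?add0r ?linearZ //.
  by apply: ideal_pow_le kr; exact: leq_maxr.
rewrite hv to_ext_quotientZ -scalerDr in bh ch.
split=> s ks; apply/quotmod_pi_eq0; rewrite quotmod_piZ ?quotmod_piB reprK -scalerA.
  by apply: bh; apply: ideal_pow_le ks; exact: leq_maxl.
by rewrite scalerBr; apply: ch; apply: ideal_pow_le ks; exact: leq_maxl.
Qed.

Lemma near_gluedS n y : near_glued n.+1 y -> near_glued n y.
Proof.
by move=> [k Hk]; exists k => r /Hk[Hb Hc]; split=> s ks; apply: ext_smulS; [exact: Hb|exact: Hc].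
Qed.

(** The solutions of [near_glued n] form a coset of a submodule U n that decreases with n, so linear
    compactness gives a common solution. *)
Lemma near_glued_all : exists y, forall n, near_glued n y.
Proof.
have /choice[y yP] := near_glued_exists.
have T_ n : exists U : submodule Mc, forall z, U z <-> exists k, forall r, ideal_pow m k r ->
    forall s, ideal_pow b k s \/ ideal_pow c k s -> T n ((s * rho r) *: z).
  have @U : submodule Mc.
  { apply: (@Submodule S Mc (fun z => exists k, forall r, ideal_pow m k r ->
      forall s, ideal_pow b k s \/ ideal_pow c k s -> T n ((s * rho r) *: z))).
    - by exists 0%N => r _ s _; rewrite scaler0; exact: submod0.
    - move=> z1 z2 [k1 H1] [k2 H2]; exists (maxn k1 k2) => r kr s ks.
      rewrite scalerDr; apply: submodD.
        apply: H1; first by apply: ideal_pow_le kr; exact: leq_maxl.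
        by case: ks => ks; [left|right]; apply: ideal_pow_le ks; exact: leq_maxl.
      apply: H2; first by apply: ideal_pow_le kr; exact: leq_maxr.
      by case: ks => ks; [left|right]; apply: ideal_pow_le ks; exact: leq_maxr.
    - move=> t z [k H]; exists k => r kr s ks.
      by rewrite scalerA mulrC -scalerA; apply: submodZ; exact: H. }
  by exists U.
have {T_} /choice[U UP] := T_.
have near_U n z t : near_glued n z -> near_glued n t -> U n (t - z).
  move=> [k1 H1] [k2 H2]; apply/UP; exists (maxn k1 k2) => r kr s.
  have [|b1 c1] := H1 r; first by apply: ideal_pow_le kr; exact: leq_maxl.
  have [|b2 c2] := H2 r; first by apply: ideal_pow_le kr; exact: leq_maxr.
  case=> ks.
    rewrite scalerBr; apply: submodB; [apply: b2|apply: b1]; apply: ideal_pow_le ks.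
      exact: leq_maxr.
    exact: leq_maxl.
  have -> : t - z = (x - z) - (x - t) by rewrite opprB [RHS]addrC addrA subrK.
  rewrite scalerBr; apply: submodB; [apply: c1|apply: c2]; apply: ideal_pow_le ks.
    exact: leq_maxl.
  exact: leq_maxr.
have U_near n z t : near_glued n z -> U n (t - z) -> near_glued n t.
  move=> [k1 H1] /UP[k2 H2]; exists (maxn k1 k2) => r kr.
  have [|b1 c1] := H1 r; first by apply: ideal_pow_le kr; exact: leq_maxl.
  have {}kr : ideal_pow m k2 r by apply: ideal_pow_le kr; exact: leq_maxr.
  split=> s ks.
    rewrite -[t](subrK z) scalerDr; apply: submodD.
      by apply: H2 => //; left; apply: ideal_pow_le ks; exact: leq_maxr.
    by apply: b1; apply: ideal_pow_le ks; exact: leq_maxl.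
  have -> : x - t = (x - z) - (t - z) by rewrite opprB addrA subrK.
  rewrite scalerBr; apply: submodB.
    by apply: c1; apply: ideal_pow_le ks; exact: leq_maxl.
  by apply: H2 => //; right; apply: ideal_pow_le ks; exact: leq_maxr.
have [||y0 Hy0] := @completion_mod_linearly_compact R m M noethR R_local M_fg U _ y.
- move=> n z /UP[k H]; apply/UP; exists k => r kr s ks; apply: ext_smulS; exact: H.
- by move=> n; apply: near_U => //; exact: near_gluedS.
by exists y0 => n; exact: U_near (yP n) (Hy0 n).
Qed.

End Gluing.

(** * Connectedness of the punctured closed set *)

Lemma smul_eq_scaled (A : comPzRingType) (V : lmodType A) (I : ideal A) (v : V) :
  noetherian A -> noetherian_module V -> exists n, forall s : A,
    ideal_smul (ideal_pow I n) (full_submodule V) (s *: v) ->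
    exists2 t, I t & s *: v = t *: v.
Proof.
move=> noethA noethV.
have [||n Hn] := @artin_rees_weak A V noethA noethV I
  (submod_adjoin (zero_submodule V) I v)
  (submod_adjoin (zero_submodule V) (full_submodule A^o) v).
- by move=> y [r Ir Hr]; exists r.
- exact: ideal_smul_adjoin.
exists n => s /Hn[|t It /subr0_eq st]; first exact: submod_adjoin_mem.
by exists t.
Qed.

Theorem corollary5p12 (R : comNzRingType) (m a : ideal R) (M : lmodType R)
  (R_noetherian : noetherian R)
  (R_local : local_ring m)
  (a_sub_m : a `<=` m)
  (M_fg : finitely_generated (full_submodule M))
  (E : forall n, injective_resolution (adic_quotient a M n))
  (phi : forall n, resolution_map (@adic_proj R a M n) (E n.+1) (E n))
  (lim_vanishes : forall i : nat, (i <= 1)%N ->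
     forall z : formal_local_cohomology m phi i, z = 0)
  (p : Spec (completion_ring m))
  (p_ass : associated_prime (completion m M) p) :
  connected (Vspec (submodule_sum (ideal_ext m a) p) `\`
             Vspec (completion_ideal m)).
Proof.
have [x px] := p_ass.
set S := completion_ring m in p p_ass x px *; set mS := completion_ideal m.
set J := submodule_sum (ideal_ext m a) p.
pose noethS := completion_noetherian R_noetherian R_local.
pose noethM := completion_mod_noetherian R_noetherian R_local M_fg.
(* B is a nonempty part, open through C, the complement of V(c), and closed through D = V(b). If B
   is not everything, there is a point q2 outside; b is contained in q1 only and c in q2 only. *)
move=> B [q1 Bq1] [C [c C_c] BC] [D openD BD].
have [b D_b] : zariski_open (~` D) by exact: closed_openC openD.
apply: contrapT => BA.
have [q2 [[Jq2 mq2] nBq2]] : exists q2 : Spec S, (Vspec J `\` Vspec mS) q2 /\ ~ B q2.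
  apply: contrapT => H; apply: BA; apply/seteqP; split=> q; first by rewrite BC => -[].
  by move=> Aq; apply: contrapT => nBq; apply: H; exists q.
have D_E q : D q <-> b `<=` q.
  have -> : D = Vspec b by apply: setC_inj.
  by [].
have C_E q : C q <-> ~ (c `<=` q) by rewrite C_c.
have [[Jq1 mq1] Cq1] : (Vspec J `\` Vspec mS) q1 /\ C q1 by rewrite BC in Bq1; case: Bq1.
have bq1 : b `<=` q1 by rewrite BD in Bq1; case: Bq1 => _ /D_E.
have {}Cq1 : ~ (c `<=` q1) by apply/C_E.
have cq2 : c `<=` q2.
  by apply: contrapT => /C_E Cq2; apply: nBq2; rewrite BC; split.
have bq2 : ~ (b `<=` q2).
  by move=> /D_E Dq2; apply: nBq2; rewrite BD; split.
(* As b lies in the proper ideal q1 it contains no unit. This settles [cover] at primes over mS. *)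
have b_sub_mS : b `<=` mS.
  move=> s bs; apply: contrapT => /(completion_unit R_noetherian R_local)[u us].
  by apply: (@prime_proper _ q1); rewrite -us; apply: (@submodZ _ S^o); exact: bq1.
(* V(b) may contain primes that are not over J, where B gives no information; adding J excludes them
   from [meet]. *)
pose b' := submodule_sum b J.
have cover (q : Spec S) : J `<=` q -> b' `<=` q \/ c `<=` q.
  move=> Jq; have [cq|ncq] := pselect (c `<=` q); [by right|left].
  apply: submodule_sum_sub => //.
  have [mq|nmq] := pselect (mS `<=` q); first by move=> s /b_sub_mS/mq.
  have : B q by rewrite BC; split=> //; apply/C_E.
  by rewrite BD => -[_ /D_E].
have meet (q : Spec S) : b' `<=` q -> c `<=` q -> mS `<=` q.
  move=> b'q cq; apply: contrapT => nmq.
  have Jq : J `<=` q by move=> s Js; apply: b'q; exact: submodule_sumr.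
  have : B q.
    by rewrite BD; split=> //; apply/D_E => s bs; apply: b'q; exact: submodule_suml.
  by rewrite BC => -[_ /C_E]; apply.
have [y yP] := @near_glued_all R m a M R_noetherian R_local M_fg x p b' c
  (fun s => iffLR (px s)) cover meet E phi (lim_vanishes 1%N isT).
(* A prime q over J that contains neither mS nor d cannot contain the products of m^k and d^k. It is
   used for c at q1 and for b' at q2. *)
have not_prime (q : Spec S) (d : ideal S) k : J `<=` q -> ~ (mS `<=` q) -> ~ (d `<=` q) ->
    ~ (forall r s, ideal_pow m k r -> ideal_pow d k s -> J (s * completion_of m r)).
  move=> Jq mq dq H.
  have [s ds nqs] : exists2 s, d s & ~ q s.
    apply: contrapT => H'; apply: dq => s ds; apply: contrapT => qs.
    by apply: H'; exists s.
  have [r mr nqr] : exists2 r, ideal_pow m 1 r & ~ q (completion_of m r).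
    apply: contrapT => H'; apply: mq; apply: (@completion_ker_ext R m R_noetherian 1) => r mr.
    by apply: contrapT => qr; apply: H'; exists r.
  have mkr : ideal_pow m k (r ^+ k).
    by apply: ideal_powX; exact: ideal_pow_mem mr.
  have /Jq : J (s ^+ k * completion_of m (r ^+ k)) by apply: H => //; exact: ideal_powX.
  by rewrite rmorphXn => /prime_mul[] /prime_exp.
(* If s0 kills y, then s0 x = s0 (x - y), which powers of c and m multiply into a^n M^. Artin-Rees
   gives (s r - t) s0 x = 0 with t in aS, and p is prime without s0, so s r - t is in p. Otherwise
   the annihilator of y lies in p, and y itself plays this part with b'. *)
have [[s0 ys0 nps0]|Hy] := pselect (exists2 s0 : S, s0 *: y = 0 & ~ p s0).
  have [n Hn] := @smul_eq_scaled S _ (ideal_ext m a) (s0 *: x) noethS noethM.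
  have [k Hk] := yP n.
  apply: (not_prime q1 c k Jq1 mq1 Cq1) => r s mr cs.
  have [t at_ st] : exists2 t, ideal_ext m a t &
      (s * completion_of m r) *: (s0 *: x) = t *: (s0 *: x).
    apply: Hn; have := (Hk r mr).2 s cs => /(submodZ s0).
    by rewrite scalerA mulrC -scalerA scalerBr ys0 subr0.
  apply/submodule_sumP; exists t => //.
  have : p ((s * completion_of m r - t) * s0).
    by apply/px; rewrite -scalerA scalerBl st subrr.
  by case/prime_mul.
have [n Hn] := @smul_eq_scaled S _ (ideal_ext m a) y noethS noethM.
have [k Hk] := yP n.
apply: (not_prime q2 b' k Jq2 mq2) => [b'q2|r s mr bs].
  by apply: bq2 => s bs; apply: b'q2; exact: submodule_suml.
have [t at_ st] := Hn _ ((Hk r mr).1 s bs).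
apply/submodule_sumP; exists t => //.
apply: contrapT => nps; apply: Hy; exists (s * completion_of m r - t) => //.
by rewrite scalerBl st subrr.
Qed.
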